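(* Let $K_d$ be the complete metric graph on $d$ vertices with all edge lengths equal to $1$, let $g=\frac{(d-1)(d-2)}{2}$, and let $(\gamma_r)_{r\geq 1}$ be the gonality sequence of this metric graph. Then for every integer $r\ge 1$: \[ \gamma_r=\begin{cases} kd-h & \text{if } r<g,\\ g+r & \text{if } r\geq g,\end{cases} \] where, in the case $r<g$, $k$ and $h$ are the uniquely determined integers with $1\leq k\leq d-3$ and $0\leq h\leq k$ such that $r=\frac{k(k+3)}{2}-h$.
   Context: The complete metric graph $K_d$ is the metric graph obtained from the complete graph on $d$ vertices by identifying every edge with a closed interval of length $1$, glued at the vertices. Let $\Gamma$ be a metric graph. A divisor on $\Gamma$ is an element $D=\sum_{p\in\Gamma}a_p(p)$ of the free abelian group on the points of $\Gamma$ (so $a_p\in\mathbb{Z}$, finitely many nonzero; write $D(p)=a_p$). Its degree is $\deg(D)=\sum_p a_p$, and $D$ is effective ($D\geq 0$) if $a_p\geq0$ for all $p$. A rational function on $\Gamma$ is a continuous, piecewise linear function $f:\Gamma\to\mathbb{R}$ with integer slopes and finitely many pieces; its principal divisor $\mathrm{div}(f)$ has as coefficient at $p$ the sum of the incoming slopes of $f$ at $p$. Two divisors are linearly equivalent, $D_1\sim D_2$, if $D_1-D_2=\mathrm{div}(f)$ for some rational function $f$. The linear system of $D$ is $|D|=\{E : E\geq0,\ E\sim D\}$. The rank $\mathrm{rk}_\Gamma(D)$ is $-1$ if $|D|=\emptyset$; otherwise it is the largest integer $r\geq0$ such that $|D-E|\neq\emptyset$ for every effective divisor $E$ on $\Gamma$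 of degree $r$. The gonality sequence $(\gamma_r)_{r\geq1}$ of $\Gamma$ is defined by $\gamma_r=\min\{s : \text{there exists a divisor on } \Gamma \text{ of degree } s \text{ and rank } r\}$. *)

(* Defs.v *)
From HB Require Import structures.
From mathcomp Require Import all_boot all_order all_algebra.
From mathcomp Require Import classical_sets reals.
From mathcomp Require Import freeg.

Set Implicit Arguments.
Unset Strict Implicit.
Unset Printing Implicit Defensive.

Import Order.TTheory GRing.Theory Num.Theory.

Local Open Scope classical_set_scope.
Local Open Scope ring_scope.

(* A metric graph is given by a model: a finite graph in which the edge [e]
   is identified with the interval [0, len e], the end 0 being glued to [src e]
   and the end [len e] to [tgt e]. *)
Record metric_graph (R : realType) := MetricGraph {
  vertex : finType;
  edge : finType;
  src : edge -> vertex;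
  tgt : edge -> vertex;
  len : edge -> R;
  len_gt0 : forall e, 0 < len e
}.

Section MetricGraph.
Variables (R : realType) (G : metric_graph R).

(* The glued space: each point is either a vertex or lies in the interior of
   exactly one edge, at a unique parameter. *)
Definition edge_interior := {x : edge G * R | 0 < x.2 < len x.1}.
Definition point := (vertex G + edge_interior)%type.

(* The parametrization [0, len e] -> G of the edge [e] (clamped outside). *)
Definition edge_point (e : edge G) (t : R) : point :=
  if insub (e, t) is Some x then inr x
  else inl (if t <= 0 then src e else tgt e).

Definition divisor := {freeg point / int}.

Definition effective (D : divisor) := forall p, 0 <= coeff p D.

(* Every edge has a finite subdivision such that [f] is affine with an integer
   slope on each closed piece.  Consecutive closed pieces share an endpoint and
   the ends of the parametrizations are the vertices themselves, so continuity
   on the whole graph is part of this condition. *)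
Definition rational (f : point -> R) := forall e : edge G,
  exists (n : nat) (t : nat -> R) (m : nat -> int),
    [/\ t 0%N = 0, t n = len e,
        forall i, (i < n)%N -> t i < t i.+1 &
        forall i x, (i < n)%N -> t i <= x <= t i.+1 ->
          f (edge_point e x) = f (edge_point e (t i)) + (m i)%:~R * (x - t i)].

(* The slope of [f] towards the point at parameter [t] of [e], along the side
   of parameters t + sg * eps, where [sg] is 1 or -1.  For a rational function
   and a side contained in the edge, exactly one integer [s] satisfies the
   condition; the default value 0 is irrelevant. *)
Definition incoming_slope (f : point -> R) (e : edge G) (t sg : R) : int :=
  xget 0 [set s : int | exists2 delta : R, 0 < delta &
    forall eps, 0 < eps < delta ->
      f (edge_point e t) - f (edge_point e (t + sg * eps)) = s%:~R * eps].

(* A loop at [v] contributes to both sums. *)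
Definition div_coeff (f : point -> R) (p : point) : int :=
  match p with
  | inl v => \sum_(e : edge G | src e == v) incoming_slope f e 0 1
             + \sum_(e : edge G | tgt e == v) incoming_slope f e (len e) (-1)
  | inr x => incoming_slope f (val x).1 (val x).2 1
             + incoming_slope f (val x).1 (val x).2 (-1)
  end.

Definition is_principal (f : point -> R) (D : divisor) :=
  forall p, coeff p D = div_coeff f p.

Definition lin_equiv (D1 D2 : divisor) :=
  exists2 f, rational f & is_principal f (D1 - D2).

Definition linear_system (D : divisor) : set divisor :=
  [set E | effective E /\ lin_equiv E D].

Definition rank_at_least (D : divisor) (r : int) :=
  forall E : divisor, effective E -> deg E = r -> linear_system (D - E) !=set0.

Definition has_rank (D : divisor) (r : int) :=
  (linear_system D = set0 /\ r = -1) \/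
  [/\ linear_system D !=set0, 0 <= r, rank_at_least D r &
      forall r' : int, 0 <= r' -> rank_at_least D r' -> r' <= r].

(* [gonality r s]: the minimum defining the r-th term of the gonality sequence
   is attained and equals [s]. *)
Definition gonality (r : nat) (s : int) :=
  (exists2 D : divisor, deg D = s & has_rank D r%:Z) /\
  (forall D : divisor, has_rank D r%:Z -> s <= deg D).

End MetricGraph.

Definition complete_metric_graph (R : realType) (d : nat) : metric_graph R :=
  @MetricGraph R 'I_d {e : 'I_d * 'I_d | (e.1 < e.2)%N}
    (fun e => (val e).1) (fun e => (val e).2) (fun=> 1) (fun=> ltr01).

(* Truncated subtraction is harmless: 1 <= k <= d - 3 forces d >= 4, and
   h <= k <= k(k+3)/2. *)
Definition gonality_indices (d r k h : nat) : Prop :=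
  [/\ (1 <= k <= d - 3)%N, (h <= k)%N & r = (k * (k + 3) %/ 2 - h)%N].

(* Main.v *)
(* Fix a divisor D on K_d.  For every real function phi on the vertices, D is
   equivalent to a divisor N(phi) having at most one chip inside each edge and
   chips phi i = a_i + sum_j floor(t_ij + phi_j - phi_i) chips at the vertex i,
   where t is antisymmetric; for generic phi no t_ij + phi_j - phi_i is an
   integer and the vertex chips sum to deg D - d(d-1)/2.
   - If all chips phi i are negative then |D| is empty: a rational function f
     with N(phi) + div f >= 0 strictly decreases along some edge leaving a
     vertex that minimizes f among the vertices, and the single chip inside that
     edge cannot make it increase again.
   - Conversely, by Dhar's burning algorithm, either some N(phi) is effective,
     or some generic phi makes all vertex chips negative.
   - Lower bound: a generic phi minimizing the sum of (chips phi i)^2 has a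
     gap-free set of values z_i = chips phi i + 1.  Removing from D the positive
     parts of z at the vertices leaves an empty linear system, hence
     rank D < sum z^+; as p gap-free positive integers sum to at most p(p+1)/2,
     and likewise for z^-, this bounds deg D from below.
   - Upper bound: for k times the sum of the vertices the z_i are distinct, so
     sum z^+ >= (k+1)(k+2)/2, and no effective divisor of degree k(k+3)/2 can
     bring all of them down to 0.  Removing h more chips gives degree kd - h. *)
Require Import Defs.
From mathcomp Require Import all_boot all_order all_algebra.
From mathcomp Require Import boolp classical_sets reals.
From mathcomp Require Import freeg zify ring lra.
(* [classical_sets] also defines [point]. *)
Require Import Defs.

Set Implicit Arguments.
Unset Strict Implicit.
Unset Printing Implicit Defensive.

Import Order.TTheory GRing.Theory Num.Theory.
Local Open Scope ring_scope.

(** * Sums of gap-free and of distinct integers *)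

Section SumNat.
Variable T : finType.
Implicit Type f : T -> nat.
Local Notation supp f := #|[set i | 0 < f i]%N|.

Lemma sum_predn f : (\sum_i f i = supp f + \sum_i (f i).-1)%N.
Proof.
rewrite -sum1dep_card [X in (X + _)%N]big_mkcond -big_split /=; apply: eq_bigr => i _.
by case: (f i).
Qed.

Lemma supp_predn_lt f i : f i = 1%N -> (supp (fun j => (f j).-1) < supp f)%N.
Proof.
move=> fi; apply: proper_card; apply/properP; split.
  by apply/fintype.subsetP => j; rewrite !inE; case: (f j) => [|[]].
by exists i; rewrite !inE fi.
Qed.

(** Induction on the number p of positive values. Lowering them all by one removes p from the sum
    and keeps gap-freeness; since the value 1 is attained, p drops by at least one. *)
Lemma sum_gapfree_le f :
    (forall m i, (m.+1 < f i)%N -> exists j, f j = m.+1) ->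
  (2 * \sum_i f i <= supp f * (supp f + 1))%N.
Proof.
have [n] := ubnP (supp f); elim: n f => // n IH f sf gap.
have [s0|/card_gt0P[i]] := posnP (supp f).
  rewrite big1 // => i _; apply/eqP.
  by have := cards0_eq s0 => /setP/(_ i); rewrite !inE lt0n => /negbFE.
rewrite inE => fi; have [j fj] : exists j, f j = 1%N.
  by have [/gap//|fi1] := ltnP 1 (f i); exists i; apply/eqP; rewrite eqn_leq fi1.
have lt := supp_predn_lt fj.
have /IH : (supp (fun j => (f j).-1) < n)%N by apply: leq_trans lt _.
rewrite (sum_predn f) => IHf.
suff {}/IHf : forall m i, (m.+1 < (f i).-1)%N -> exists j, (f j).-1 = m.+1 by nia.
move=> m l fl; have [|l' fl'] := gap m.+1 l; first by case: (f l) fl.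
by exists l'; rewrite fl'.
Qed.

(** Same reduction as for [sum_gapfree_le], but now the value 1 is taken at most once, so the
    support loses at most one element. It may lose none, hence the induction on the sum. *)
Lemma sum_inj_ge f :
    (forall i j, (0 < f i)%N -> f i = f j -> i = j) ->
  (supp f * (supp f + 1) <= 2 * \sum_i f i)%N.
Proof.
have [n] := ubnP (\sum_i f i)%N; elim: n f => // n IH f sf inj.
have [s0|s_gt0] := posnP (supp f); first by rewrite s0.
have Sf := sum_predn f.
pose g j := (f j).-1.
have sg : (supp f <= (supp g).+1)%N.
  have [[i fi]|no] := pselect (exists i, f i = 1%N); last first.
    apply/leqW/subset_leq_card/fintype.subsetP => j; rewrite !inE /g.
    by case E : (f j) => [|[|k]]// _; case: no; exists j.
  rewrite (cardsD1 i) -[X in (_ <= X)%N]add1n leq_add ?leq_b1//.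
  apply/subset_leq_card/fintype.subsetP => j; rewrite !inE /g => /andP[ij].
  case E : (f j) => [|[|k]]// _; case/eqP: ij.
  by apply: inj; rewrite E ?fi.
have /IH IHg : (\sum_i g i < n)%N by rewrite /g; lia.
suff /IHg : forall i j, (0 < g i)%N -> g i = g j -> i = j by rewrite /g in sg *; nia.
by move=> i j; rewrite /g => gi e; apply: inj; lia.
Qed.
End SumNat.

(** * Integer inequalities relating degree, rank and signed sums *)

Lemma consecutive_ge0 (x y : int) : 0 <= (x - 2 - y) * (x - 1 - y).
Proof. by have [|] := lerP 0 (x - 2 - y); nia. Qed.

(** Here [S] and [N] are the sums of the positive and negative parts of [chips + 1], and [s] is the
    degree; the third hypothesis is [sum_chips] in these terms. *)
Lemma plane_degree_bound (d r k h S N : nat) (s : int) :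
    (2 * (r + h) = k * (k + 3))%N -> r%:Z < S%:Z ->
    2 * (S%:Z - N%:Z) = 2 * s + 2 * d%:Z - (d * (d - 1))%:Z ->
    2 * N%:Z <= (d%:Z - 2 - k%:Z) * (d%:Z - 1 - k%:Z) ->
  k%:Z * d%:Z - h%:Z <= s.
Proof.
have -> : (d * (d - 1))%:Z = d%:Z * (d%:Z - 1) by case: d => // n; nia.
by move=> *; nia.
Qed.

Lemma nonspecial_degree_bound (d r g S : nat) (s : int) : (0 < d)%N ->
    (2 * g = (d - 1) * (d - 2))%N -> (r < S)%N ->
    2 * S%:Z = 2 * s + 2 * d%:Z - (d * (d - 1))%:Z ->
  g%:Z + r%:Z <= s.
Proof. by case: d => [|[|n]] //; nia. Qed.

(** The total of the vertex chips is at least g - d(d-1)/2 = -(d-1), so the d vertices cannot all be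
    negative. *)
Lemma nonspecial_sum_bound (d g : nat) (s S : int) : (0 < d)%N ->
    (2 * g = (d - 1) * (d - 2))%N -> g%:Z <= s -> S <= - d%:Z ->
  2 * S = 2 * s - (d * (d - 1))%:Z -> False.
Proof. by case: d => [|[|n]] //; nia. Qed.

Lemma triangle_lt (k S P : nat) :
  (k * (k + 1) < 2 * S)%N -> (2 * S <= P * (P + 1))%N -> (k < P)%N.
Proof. by move=> *; nia. Qed.

Lemma double_genus d : (2 * ((d - 1) * (d - 2) %/ 2) = (d - 1) * (d - 2))%N.
Proof.
case: d => [|[|n]] //; rewrite !subSS !subn0 (mulnC n.+1) mulnC divnK //.
by rewrite dvdn2 oddM /= andbN.
Qed.

(** The term with [b] is the drop caused by a perturbation. It occurs only at an integral [x], where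
    [x - y], not being an integer, already has a strictly smaller floor. *)
Lemma floor_shift_bound (R : realType) (x y : R) (n : int) (b : bool) :
    0 <= y <= n%:~R -> x - y \isn't a Num.int ->
  0 <= Num.floor x - (b && (x \is a Num.int))%:Z - Num.floor (x - y) <= n.
Proof.
move=> /andP[y0 yn] xy; have fxy : Num.floor (x - y) <= Num.floor x.
  by apply: le_floor; lra.
have fxn : Num.floor x - n <= Num.floor (x - y).
  by rewrite floor_ge_int intrB; have := floor_le x; lra.
have fxy1 : x \is a Num.int -> Num.floor (x - y) < Num.floor x.
  rewrite intrEfloor => /eqP xE; rewrite lt_neqAle fxy andbT; apply: contraNneq xy.
  move=> fE; have := floor_le (x - y); rewrite fE xE => xxy.
  by have -> : x - y = (Num.floor x)%:~R; [rewrite xE; lra | rewrite intr_int].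
move: (Num.floor x) (Num.floor (x - y)) fxy fxn fxy1 => u v vu un.
by case: b (x \is a Num.int) => [] [] /= lt; try have := lt isT; clear lt; lia.
Qed.

Section SignedSums.
Variable T : finType.
Implicit Type z : T -> int.

Definition pos_part z i : nat := if z i is Posz n then n else 0%N.
Definition neg_part z i : nat := if z i is Negz n then n.+1 else 0%N.
Local Notation supp f := #|[set i | 0 < f i]%N|.

Lemma pos_neg_part z i : z i = (pos_part z i)%:Z - (neg_part z i)%:Z.
Proof. by rewrite /pos_part /neg_part; case: (z i) => n; lia. Qed.

Lemma sum_pos_neg_part z :
  \sum_i z i = (\sum_i pos_part z i)%N%:Z - (\sum_i neg_part z i)%N%:Z.
Proof.
rewrite !(big_morph Posz PoszD (erefl 0%Z)) -sumrB.
by apply: eq_bigr => i _; apply: pos_neg_part.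
Qed.

Lemma card_supp_parts z :
  (supp (pos_part z) + supp (neg_part z) + #|[set i | z i == 0]| = #|T|)%N.
Proof.
rewrite -!sum1dep_card -sum1_card [X in (X + _ + _)%N]big_mkcond.
rewrite [X in (_ + X + _)%N]big_mkcond [X in (_ + _ + X)%N]big_mkcond -!big_split /=.
apply: eq_bigr => i _; rewrite /pos_part /neg_part.
by case: (z i) => [[|n]|n].
Qed.

Definition gapfree z := forall m i j, z i < m -> m < z j -> exists l, z l = m.

(** As [z] takes both signs, it takes the value 0; this index makes [P + N] strictly smaller than
    the cardinality. Each sign separately is then gap-free down to 1. *)
Lemma gapfree_sums z i : gapfree z -> z i < 0 -> (0 < \sum_l pos_part z l)%N ->
  exists P N, [/\ (P + N < #|T|)%N, (0 < N)%N,
    (2 * \sum_l pos_part z l <= P * (P + 1))%N &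
    (2 * \sum_l neg_part z l <= N * (N + 1))%N].
Proof.
move=> gap zi S_gt0.
have [j zj] : exists j, 0 < z j.
  apply: contrapT => no; move: S_gt0; rewrite big1 // => l _.
  rewrite /pos_part; case E : (z l) => [[|n]|n] //.
  by case: no; exists l; rewrite E.
have [o zo] := gap 0 i j zi zj.
exists (supp (pos_part z)), (supp (neg_part z)); split.
- have := card_supp_parts z; rewrite [#|[set l | z l == 0]|](cardD1 o) inE zo eqxx.
  lia.
- by apply/card_gt0P; exists i; rewrite inE /neg_part; case: (z i) zi.
- apply: sum_gapfree_le => m l ml; have [||k zk] := gap m.+1%:Z i l.
  + by lia.
  + by move: ml; rewrite /pos_part; case: (z l).
  + by exists k; rewrite /pos_part zk.
- apply: sum_gapfree_le => m l ml; have [||k zk] := gap (Negz m) l j.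
  + by move: ml; rewrite /neg_part; case: (z l) => // n; lia.
  + by lia.
  + by exists k; rewrite /neg_part zk.
Qed.

(** At most one value is 0, which accounts for the 1 in the first bound. *)
Lemma injective_sums z : injective z -> exists P N,
  [/\ (#|T| <= P + N + 1)%N,
    (P * (P + 1) <= 2 * \sum_l pos_part z l)%N &
    (N * (N + 1) <= 2 * \sum_l neg_part z l)%N].
Proof.
move=> inj; exists (supp (pos_part z)), (supp (neg_part z)); split.
- rewrite -(card_supp_parts z) leq_add2l.
  have [->|[o /[1!inE] /eqP zo]] := set_0Vmem [set i | z i == 0].
    by rewrite cards0.
  rewrite -(cards1 o) subset_leq_card //; apply/fintype.subsetP => l.
  by rewrite !inE => /eqP zl; apply/eqP/inj; rewrite zl.
- apply: sum_inj_ge => i j; rewrite /pos_part => zi zij; apply: inj.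
  by case: (z i) (z j) zi zij => [m|m] [n|n] //= => [_ ->|/[swap] ->].
- apply: sum_inj_ge => i j; rewrite /neg_part => zi zij; apply: inj.
  by case: (z i) (z j) zi zij => [m|m] [n|n] //= _ [->].
Qed.

End SignedSums.

(** * Chip configurations *)

(** Lets finitely many conditions on a sufficiently small number share one threshold. *)
Lemma exists_small (R : realType) (I : finType) (P : I -> R -> Prop) :
    (forall i, exists2 d, 0 < d & forall e, 0 < e < d -> P i e) ->
  exists2 d, 0 < d & forall e, 0 < e < d -> forall i, P i e.
Proof.
move=> Psmall; have /choice[d dP] i :
    exists d, 0 < d /\ forall e, 0 < e < d -> P i e.
  by have [d d_gt0 Pd] := Psmall i; exists d.
exists (\big[Num.min/1]_i d i); first by apply: lt_bigmin => // i _; case: (dP i).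
move=> e /andP[e_gt0 e_lt] i; apply: (dP i).2; rewrite e_gt0.
exact: lt_le_trans e_lt (bigmin_le _ _ _).
Qed.

Lemma floor_itvoo (R : realType) (x : R) (n : int) : n%:~R < x < n%:~R + 1 ->
  Num.floor x = n /\ x \isn't a Num.int.
Proof.
move=> /andP[nx xn].
have xE : Num.floor x = n by apply: floor_def; rewrite ltW//= intrD.
by split=> //; rewrite intrEfloor xE lt_eqF.
Qed.

(** The floor is locally constant to the right of every point, and to the left of every point except
    the integers, where it jumps by one. *)
Lemma floor_perturb (R : realType) (x m : R) :
  exists2 d, 0 < d & forall e, 0 < e < d ->
    Num.floor (x + e * m) = Num.floor x - ((m < 0) && (x \is a Num.int))%:Z /\
    (x + e * m \is a Num.int) = (m == 0) && (x \is a Num.int).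
Proof.
have := floor_itv x; set n := Num.floor x; rewrite intrD => /andP[nx xn].
have small c : m != 0 -> 0 < c ->
    exists2 d, 0 < d & forall e, 0 < e < d -> 0 < e * `|m| < c.
  rewrite -normr_gt0 => m0 c0; exists (c / `|m|); first exact: divr_gt0.
  by move=> e /andP[e0]; rewrite ltr_pdivlMr // mulr_gt0.
have [m_lt0|m_gt0|->] := ltgtP m 0.
- have [/[1!intrEfloor]/eqP-/esym xE|xnint] := boolP (x \is a Num.int).
    rewrite -/n in xE.
    have [d d0 dP] := small 1 (ltr0_neq0 m_lt0) ltr01.
    exists d => // e /dP; rewrite ltr0_norm // => eP.
    have [|-> /negbTE ->//] := @floor_itvoo _ (x + e * m) (n - 1).
    by rewrite intrB; apply/andP; split; lra.
  have {}nx : n%:~R < x by rewrite lt_neqAle nx andbT -intrEfloor.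
  have [||d d0 dP] := small (x - n%:~R); rewrite ?ltr0_neq0 ?subr_gt0 //.
  exists d => // e /dP; rewrite ltr0_norm // => eP; rewrite andbF subr0.
  have [|-> /negbTE ->//] := @floor_itvoo _ (x + e * m) n.
  by apply/andP; split; lra.
- have [||d d0 dP] := small (n%:~R + 1 - x); rewrite ?gt_eqF ?subr_gt0 //.
  exists d => // e /dP; rewrite gtr0_norm // => eP; rewrite subr0.
  have [|-> /negbTE ->//] := @floor_itvoo _ (x + e * m) n.
  by apply/andP; split; lra.
- by exists 1 => // e _; rewrite mulr0 addr0 subr0.
Qed.

Lemma floorNnint (R : realType) (x : R) :
  Num.floor (- x) = - Num.floor x - (x \isn't a Num.int)%:Z.
Proof.
have [xint|xnint] := boolP (x \is a Num.int); first by rewrite floorN // subr0.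
have /andP[] := floor_itv x; rewrite intrD le_eqVlt -intrEfloor (negbTE xnint) /=.
move=> nx xn; have [|//] := @floor_itvoo _ (- x) (- Num.floor x - 1).
by rewrite intrB intrN; apply/andP; split; lra.
Qed.

(* Dhar's burning algorithm: [rho] is the order in which the elements burn, the
   fire starting at [q]. *)
Lemma burning_order (T : finType) (q : T) (c : T -> int) (r : rel T) :
    (forall S : {set T}, q \in S -> S != [set: T] ->
       exists2 i, i \notin S & c i < #|[set j in S | r i j]|%:Z) ->
  exists2 rho : T -> nat, injective rho &
    forall i, i != q -> c i < #|[set j | (rho j < rho i)%N && r i j]|%:Z.
Proof.
move=> burn; have T_gt0 : (0 < #|T|)%N by rewrite (cardD1 q).
(* The fire is followed one element at a time: [S] is the burnt set, and an element that catches
   fire gets the current size of [S] as its time. *)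
suff [S [rho [qS cardS _ inj cS]]] : exists (S : {set T}) (rho : T -> nat),
    [/\ q \in S, #|S| = (#|T|.-1).+1, forall j, j \in S -> (rho j < #|S|)%N,
      {in S &, injective rho} & forall i, i \in S -> i != q ->
        c i < #|[set j in S | (rho j < rho i)%N && r i j]|%:Z].
  have {}cardS : S = [set: T].
    apply/eqP; rewrite eqEcard finset.subsetT cardsT cardS.
    by rewrite prednK ?leqnn.
  exists rho => [i j|i iq]; first by apply: inj; rewrite cardS inE.
  have := cS i; rewrite cardS inE => /(_ isT iq).
  by under eq_finset do rewrite inE andTb.
have : (#|T|.-1 < #|T|)%N by rewrite prednK.
elim: #|T|.-1 => [|n IH] nT.
  exists [set q], (fun=> 0%N); split; rewrite ?set11 ?cards1 //.
    by move=> i j /set1P-> /set1P->.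
  by move=> i /set1P->; rewrite eqxx.
have [S [rho [qS cardS rhoS inj cS]]] := IH (ltnW nT).
have [|i iS ci] := burn S qS.
  by apply: contraTneq nT => SE; rewrite -cardsT -SE cardS -leqNgt.
pose rho' j := if j == i then #|S| else rho j.
have rhoE j : j \in S -> rho' j = rho j.
  by rewrite /rho'; case: eqP => // -> /(negP iS).
have rhoi : rho' i = #|S| by rewrite /rho' eqxx.
exists (i |: S), rho'; split.
- by rewrite inE qS orbT.
- by rewrite cardsU1 iS cardS.
- move=> j; rewrite cardsU1 iS /= add1n ltnS => /setU1P[->|jS]; first by rewrite rhoi.
  by rewrite rhoE // ltnW // rhoS.
- move=> j k /setU1P[->|jS] /setU1P[->|kS] //; rewrite ?rhoi ?rhoE //.
  + by move=> kE; have := rhoS _ kS; rewrite -kE ltnn.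
  + by move=> kE; have := rhoS _ jS; rewrite kE ltnn.
  + exact: inj.
- move=> j /setU1P[->|jS] jq.
    apply: lt_le_trans ci _; rewrite lez_nat; apply/subset_leq_card/fintype.subsetP.
    by move=> k /[!inE] /andP[kS ->]; rewrite kS rhoi rhoE // rhoS // orbT.
  apply: lt_le_trans (cS _ jS jq) _.
  rewrite lez_nat; apply/subset_leq_card/fintype.subsetP.
  by move=> k /[!inE] /andP[kS]; rewrite !rhoE // kS orbT.
Qed.

Section Chips.
Variables (R : realType) (T : finType) (a : T -> int) (t : T -> T -> R).
Hypothesis tN : forall i j, t i j = - t j i.
Implicit Types phi w : T -> R.

Definition offset phi i j := t i j + phi j - phi i.
Definition chips phi i : int := a i + \sum_j Num.floor (offset phi i j).
(** On a complete graph this says that every edge carries its chip strictly inside, none having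
    reached a vertex. *)
Definition generic phi := forall i j, i != j -> offset phi i j \isn't a Num.int.

Lemma offsetC phi i j : offset phi i j = - offset phi j i.
Proof. by rewrite /offset tN; lra. Qed.

Lemma offset_diag phi i : offset phi i i = 0.
Proof. by have := offsetC phi i i; lra. Qed.

(** The common tool of the perturbation arguments: an injective [w] makes any [phi] generic, and the
    order of its values decides which integral offsets drop. *)
Lemma offset_perturb phi w :
  exists2 d, 0 < d & forall e, 0 < e < d -> forall i j,
    let phi' l := phi l + e * w l in
    Num.floor (offset phi' i j) = Num.floor (offset phi i j)
      - ((w j < w i) && (offset phi i j \is a Num.int))%:Z /\
    (offset phi' i j \is a Num.int) =
      (w j == w i) && (offset phi i j \is a Num.int).
Proof.
have [|d d0 dP] := @exists_small R (T * T)%type (fun ij e =>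
    let x := offset phi ij.1 ij.2 in let m := w ij.2 - w ij.1 in
    Num.floor (x + e * m) = Num.floor x - ((m < 0) && (x \is a Num.int))%:Z /\
    (x + e * m \is a Num.int) = (m == 0) && (x \is a Num.int)).
- by move=> [i j]; apply: floor_perturb.
- exists d => // e /dP {dP}dP i j /=; have := dP (i, j).
  rewrite /= subr_lt0 subr_eq0; have -> // : offset phi i j + e * (w j - w i) =
    offset (fun l => phi l + e * w l) i j by rewrite /offset; lra.
Qed.

Lemma exists_generic : exists phi, generic phi.
Proof.
have [d d0 dP] := offset_perturb (fun=> 0) (fun i => (enum_rank i)%:R).
exists (fun l => 0 + d / 2%:R * (enum_rank l)%:R) => i j ij.
have [|_ ->] := dP (d / 2%:R) _ i j; first by apply/andP; split; lra.
rewrite eqr_nat; case: eqP => // /val_inj/enum_rank_inj ji.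
by rewrite ji eqxx in ij.
Qed.

(** Each pair of distinct elements costs one chip, because the floors of x and -x add up to -1 for a
    nonintegral x. Doubling lets the two orders of a pair be matched. *)
Lemma sum_chips phi : generic phi ->
  2 * \sum_i chips phi i = 2 * (\sum_i a i) - (#|T| * (#|T| - 1))%:Z.
Proof.
move=> gen; rewrite big_split /= mulrDr; congr (_ + _).
rewrite mulr2n mulrDl !mul1r [X in _ + X]exchange_big /= -big_split /=.
have pairE i j : Num.floor (offset phi i j) + Num.floor (offset phi j i) =
    - (j != i)%:Z.
  have [->|ji] := eqVneq j i; first by rewrite offset_diag floor0.
  by rewrite [offset phi j i]offsetC floorNnint gen 1?eq_sym //; lia.
under eq_bigr => i _.
  rewrite -big_split /=; under eq_bigr => j _ do rewrite pairE.
  rewrite sumrN -(big_morph Posz PoszD (erefl 0%Z)).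
  rewrite -big_mkcond sum1_card cardC1; over.
by rewrite sumr_const -mulr_natr natz mulNr mulnC PoszM subn1.
Qed.

Lemma sum_indicator (b : bool) (i : T) : \sum_j (b && (j == i))%:Z = b%:Z.
Proof.
rewrite (bigD1 i) //= eqxx andbT big1 ?addr0 // => j /negbTE->.
by rewrite andbF.
Qed.

(* Raise [phi] uniformly on [B] up to the first integral offset between [B] and
   its complement; the perturbation [w] then lets a single pair cross. *)
Lemma fire_one phi (B : pred T) i1 j1 : generic phi -> ~~ B i1 -> B j1 ->
  exists phi' i j, [/\ generic phi', ~~ B i, B j &
    forall l, chips phi' l = chips phi l + (l == i)%:Z - (l == j)%:Z].
Proof.
move=> gen Bi1 Bj1.
(* The amount by which [phi] must rise at [p.2] for the offset to reach the next integer. *)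
pose tau (p : T * T) :=
  (Num.floor (offset phi p.1 p.2))%:~R + 1 - offset phi p.1 p.2.
pose cut (p : T * T) := ~~ B p.1 && B p.2.
have := @Order.TotalTheory.arg_minP _ _ _ (i1, j1) cut tau.
case=> [|[i0 j0] /andP[/= Bi0 Bj0] tau_min]; first exact/andP.
have i0j0 : i0 != j0 by apply: contraNneq Bi0 => ->.
set tau0 := tau (i0, j0) in tau_min.
pose phi0 l := phi l + (if B l then tau0 else 0).
(* Among the pairs from the complement of [B] into [B], only [(i0, j0)] has [w] increasing, so it
   alone keeps its raised floor. The values on the two sides are disjoint, which destroys
   integrality across the cut. *)
pose w l : R := if B l then if l == j0 then 1 else -1
                else if l == i0 then 0 else 2.
have [d d0 dP] := offset_perturb phi0 w.
pose phi' l := phi0 l + d / 2 * w l.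
have {}dP l k := dP (d / 2) (introT andP (conj _ _)) l k.
have {}dP l k : Num.floor (offset phi' l k) = Num.floor (offset phi0 l k)
      - ((w k < w l) && (offset phi0 l k \is a Num.int))%:Z /\
    (offset phi' l k \is a Num.int) =
      (w k == w l) && (offset phi0 l k \is a Num.int).
  by apply: dP; lra.
have key l k : l != k -> offset phi' l k \isn't a Num.int /\
    Num.floor (offset phi' l k) = Num.floor (offset phi l k)
    + ((l == i0) && (k == j0))%:Z - ((l == j0) && (k == i0))%:Z.
  (* By antisymmetry of the offsets, pairs leaving [B] follow from pairs entering it. *)
  wlog : l k / B l ==> B k.
    have [Blk|/[!negb_imply]/andP[Bl Bk]] := boolP (B l ==> B k).
      by move=> /(_ _ _ Blk) keylk /keylk.
    move=> keylk lk; have kl : k != l by rewrite eq_sym.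
    have [|nint E] := keylk k l _ kl; first by rewrite Bl implybT.
    rewrite [offset phi' l k]offsetC [offset phi l k]offsetC !floorNnint rpredN.
    rewrite E nint (gen _ _ kl); split=> //.
    by rewrite (andbC (k == i0)) (andbC (k == j0)) /=; ring.
  move=> Blk lk; have [-> ->] := dP l k.
  have [BB|BB] := eqVneq (B l) (B k).
    have -> : offset phi0 l k = offset phi l k.
      by rewrite /offset /phi0 BB; lra.
    rewrite (negbTE (gen _ _ lk)) !andbF; split=> //.
    have -> : (l == i0) && (k == j0) = false.
      by apply/negP => /andP[/eqP li /eqP kj]; move: BB; rewrite li kj Bj0 (negbTE Bi0).
    have -> : (l == j0) && (k == i0) = false.
      by apply/negP => /andP[/eqP li /eqP kj]; move: BB; rewrite li kj Bj0 (negbTE Bi0).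
    by rewrite /= !subr0 ?addr0.
  have [Bl Bk] : B l = false /\ B k by move: Blk BB; case: (B l) (B k) => [] [].
  have lj0 : l == j0 = false by apply: contraFF Bl => /eqP->.
  have x0E : offset phi0 l k = offset phi l k + tau0.
    by rewrite /offset /phi0 Bl Bk; lra.
  (* Pairs attaining the minimum become integral at [phi0], so [w] decides their floor; the others
     stay inside their unit interval. *)
  have := tau_min (l, k); rewrite /cut /= Bl Bk => /(_ isT).
  rewrite le_eqVlt => /orP[/eqP tauE|tau_lt].
    have {}x0E : offset phi0 l k = (Num.floor (offset phi l k) + 1)%:~R.
      by rewrite x0E tauE /tau /= intrD; lra.
    have x0int : offset phi0 l k \is a Num.int by rewrite x0E intr_int.
    rewrite x0int x0E intrKfloor lj0 !andbT /w Bl Bk.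
    have -> : ((if k == j0 then 1 else -1) == (if l == i0 then 0 else 2) :> R) = false.
      by case: (k == j0) (l == i0) => [] []; apply/eqP; lra.
    have -> : ((if k == j0 then 1 else -1) < (if l == i0 then 0 else 2) :> R) =
        ~~ ((l == i0) && (k == j0)).
      by case: (k == j0) (l == i0) => [] [] /=; apply/idP; lra.
    by case: (_ && _); rewrite /= !subr0 ?addr0 ?addrK.
  have /andP[fx _] := floor_itv (offset phi l k).
  have [|-> /negbTE ->] := @floor_itvoo _ (offset phi0 l k)
    (Num.floor (offset phi l k)).
    rewrite x0E; move: tau_lt (tau_min (i0, j0)); rewrite /tau /= => tau_lt _.
    apply/andP; split; last by lra.
    suff : 0 < tau0 by lra.
    have := floorD1_gt (offset phi i0 j0); rewrite intrD /tau0 /tau /=; lra.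
  rewrite !andbF lj0 /=; split=> //.
  case: eqP => [li|_] /=; last by rewrite !subr0 ?addr0.
  by case: eqP => [kj|_] /=; [move: tau_lt; rewrite li kj ltxx | rewrite !subr0 ?addr0].
exists phi', i0, j0; split=> // [l k /key[]//|l].
rewrite /chips -addrA -addrA; congr (_ + _).
rewrite -(sum_indicator (l == i0) j0) -(sum_indicator (l == j0) i0).
rewrite -sumrB -big_split /=; apply: eq_bigr => k _.
have [<-|/key[_ ->]] := eqVneq l k; last by rewrite addrA.
rewrite !offset_diag floor0 andbC subrr.
by rewrite addr0.
Qed.

(* Across a gap, [fire_one] moves a chip from a high to a low value and strictly
   decreases the sum of squares. *)
Lemma exists_gapfree : exists2 phi, generic phi & forall m i j,
  chips phi i < m -> m < chips phi j -> exists l, chips phi l = m.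
Proof.
have [phi gen] := exists_generic.
have [n] := ubnP (absz (\sum_i chips phi i ^+ 2)).
elim: n => // n IH in phi gen *; rewrite ltnS => en.
have [//|/existsNP[m /existsNP[i1 /existsNP[j1]]]] := pselect (forall m i j,
  chips phi i < m -> m < chips phi j -> exists l, chips phi l = m).
  by exists phi.
move=> /not_implyP[i1m /not_implyP[j1m /forallNP no]].
have Bi1 : ~~ (m < chips phi i1) by rewrite -leNgt ltW.
have [phi' [i [j [gen' Bi Bj chE]]]] :=
  @fire_one phi (fun l => m < chips phi l) i1 j1 gen Bi1 j1m.
apply: (IH phi' gen'); apply: leq_trans en.
have ij : i != j by apply: contraNneq Bi => ->.
have im : chips phi i < m by rewrite lt_neqAle leNgt Bi andbT; apply/eqP/no.
have S_ge0 psi : 0 <= \sum_l chips psi l ^+ 2 by apply: sumr_ge0 => l _; apply: sqr_ge0.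
rewrite -ltz_nat !gez0_abs //.
have ji : j != i by rewrite eq_sym.
rewrite (bigD1 i) //= (bigD1 j) //= [ltRHS](bigD1 i) //= [X in _ < _ + X](bigD1 j) //=.
rewrite (eq_bigr (fun l => chips phi l ^+ 2)) => [|l /andP[li lj]]; last first.
  by rewrite chE (negbTE li) (negbTE lj) addr0 subr0.
rewrite !chE !eqxx (negbTE ij) (negbTE ji) ?addr0 ?subr0.
(* The gap at [m] forces y >= x + 2, and then (x+1)^2 + (y-1)^2 < x^2 + y^2. *)
move: (\sum_(_ | _) _) (chips phi i) (chips phi j) im Bj => S x y xm my.
by rewrite !expr2; clear -xm my; nia.
Qed.

Section Reduced.
Variable q : T.

(* Feasible functions are stable under pointwise suprema; the largest one
   gives the [q]-reduced representative. *)
Definition feasible phi := phi q = 0 /\ forall i, i != q -> 0 <= chips phi i.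

(** Lowering [phi] by a large integer away from [q] gives every other element that many chips from
    its pair with [q]. *)
Lemma exists_feasible : exists phi, feasible phi.
Proof.
pose m i := a i + \sum_j Num.floor (t i j).
pose M := \sum_i `|m i|.
exists (fun j => if j == q then 0 else - M%:~R); split=> [|i iq]; first by rewrite eqxx.
rewrite /chips (eq_bigr (fun j => Num.floor (t i j) + (if j == q then M else 0))).
  rewrite big_split /= -big_mkcond big_pred1_eq addrA -/(m i).
  rewrite -[M in X in _ <= X]/M -lerBlDl sub0r; apply: le_trans (ler_norm _) _.
  by rewrite normrN /M (bigD1 i) //= lerDl sumr_ge0.
move=> j _; rewrite /offset (negbTE iq).
have -> : t i j + (if j == q then 0 else - M%:~R) - - M%:~R =
    t i j + (if j == q then M else 0)%:~R by case: ifP => _; lra.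
by rewrite floorDrz ?intr_int // intrKfloor.
Qed.

(** At a maximum [m] of [phi], the offsets towards the elements other than [q] are at most [t m j].
    Nonnegative chips at [m] then bound the offset towards [q] from below, hence [phi m] from
    above. *)
Lemma feasible_bounded : exists C, forall phi i, feasible phi -> phi i <= C.
Proof.
pose c i := (a i)%:~R + \sum_(j | j != q) (Num.floor (t i j))%:~R + t i q.
exists (\sum_i `|c i|) => phi i [phiq phi_ge0].
have C_ge0 : 0 <= \sum_i `|c i| by exact: sumr_ge0.
have [m _ m_max] := @Order.TotalTheory.arg_maxP _ _ _ q xpredT phi isT.
apply: le_trans (m_max i isT) _.
have [->|mq] := eqVneq m q; first by rewrite phiq.
suff m_le : phi m <= c m.
  apply: le_trans m_le _; rewrite (bigD1 m) //=.
  by apply: (le_trans (ler_norm _)); rewrite lerDl sumr_ge0.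
have := phi_ge0 m mq; rewrite /chips (bigD1 q) //=.
rewrite -(ler_int R) !intrD => ge0.
have fq := floor_le (offset phi m q).
have le_c : (\sum_(j | j != q) Num.floor (offset phi m j))%:~R <=
    \sum_(j | j != q) (Num.floor (t m j))%:~R :> R.
  rewrite rmorph_sum /=; apply: ler_sum => j _; rewrite ler_int le_floor //.
  by have := m_max j isT; rewrite /offset /=; lra.
move: ge0 fq le_c; rewrite /c [in offset _ _ q]/offset phiq; lra.
Qed.

Definition sup_feasible i : R :=
  if i == q then 0 else sup [set phi i | phi in feasible]%classic.

Lemma le_sup_feasible phi i : feasible phi -> phi i <= sup_feasible i.
Proof.
move=> fphi; rewrite /sup_feasible; case: eqP => [->|_]; first by rewrite fphi.1.
have [C leC] := feasible_bounded.
apply: ub_le_sup; last by exists phi.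
by exists C => _ [psi fpsi <-]; apply: leC.
Qed.

Lemma sup_feasible_adherent i e : 0 < e ->
  exists2 phi, feasible phi & sup_feasible i - e < phi i.
Proof.
move=> e0; have [phi0 f0] := exists_feasible.
rewrite /sup_feasible; case: eqP => [->|_]; first by exists phi0; rewrite // f0.1; lra.
have [|_ [phi fphi <-] lt_phi] :=
  @sup_adherent _ [set phi i | phi in feasible]%classic _ e0; last by exists phi.
split; first by exists (phi0 i), phi0.
have [C leC] := feasible_bounded.
by exists C => _ [psi fpsi <-]; apply: leC.
Qed.

(** A feasible [phi] close to the supremum at [i] lies below it elsewhere, so its offsets from [i]
    exceed those of the supremum by very little. Too small an excess cannot raise a floor, so the
    supremum has at least as many chips at [i]. *)
Lemma feasible_sup : feasible sup_feasible.
Proof.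
split=> [|i iq]; first by rewrite /sup_feasible eqxx.
have [j|d d0 dP] := @exists_small R T (fun j e => forall y,
    y <= offset sup_feasible i j + e ->
    Num.floor y <= Num.floor (offset sup_feasible i j)).
  have := floorD1_gt (offset sup_feasible i j); rewrite intrD => lt.
  exists ((Num.floor (offset sup_feasible i j))%:~R + 1 - offset sup_feasible i j).
    by lra.
  by move=> e elt y ylt; rewrite -ltzD1 floor_lt_int intrD; lra.
have d2 : 0 < d / 2 by lra.
have [phi fphi phi_lt] := sup_feasible_adherent i d2.
apply: le_trans (fphi.2 i iq) _; rewrite lerD2l; apply: ler_sum => j _.
apply: (dP (d / 2)); first by apply/andP; split; lra.
by have := le_sup_feasible j fphi; rewrite /offset; lra.
Qed.

(** Raising the complement of [S] slightly must break feasibility, by maximality. Elements of [S]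
    lose nothing, while an element outside loses one chip for each integral offset into [S]. *)
Lemma sup_feasible_burn (S : {set T}) : q \in S -> S != [set: T] ->
  exists2 i, i \notin S & chips sup_feasible i <
    #|[set j in S | offset sup_feasible i j \is a Num.int]|%:Z.
Proof.
move=> qS; rewrite finset.eqEsubset finset.subsetT /= => /subsetPn[k _ kS].
have [d d0 dP] := offset_perturb sup_feasible (fun l => (l \notin S)%:R).
set phi := fun l => sup_feasible l + d / 2 * (l \notin S)%:R.
have {}dP i j : Num.floor (offset phi i j) = Num.floor (offset sup_feasible i j)
    - (((j \notin S)%:R < (i \notin S)%:R :> R) &&
       (offset sup_feasible i j \is a Num.int))%:Z.
  by have [|->] := dP (d / 2) _ i j; first by apply/andP; split; lra.
have fsup := feasible_sup.
have : ~ feasible phi.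
  by move=> /(le_sup_feasible k); rewrite /phi kS mulr1; lra.
move=> /not_andP[[]|/existsNP[i /not_implyP[iq]]].
  by rewrite /phi qS fsup.1 mulr0 addr0.
move=> /negP; rewrite -ltNge /chips; under eq_bigr do rewrite dP.
rewrite sumrB addrA -/(chips _ i) subr_lt0 -(big_morph Posz PoszD (erefl 0%Z)).
have [iS|iS] := boolP (i \in S).
  rewrite big1 => [|j _]; first by move: (fsup.2 i iq) => /le_lt_trans/[apply].
  by rewrite ltNge ler0n.
move=> lt; exists i => //; apply: lt_le_trans lt _.
rewrite lez_nat -sum1dep_card [X in (_ <= X)%N]big_mkcond leq_sum // => j _.
by case: (j \in S) => /=; rewrite ?ltxx // ltr01; case: (_ \is a _).
Qed.

(** If [q] is in debt at the reduced function, perturbing along the burning order makes each other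
    element lose one chip per earlier neighbour, more than it has. Injectivity of the order gives
    genericity. *)
Lemma chips_dichotomy : (exists phi, forall i, 0 <= chips phi i) \/
  (exists2 phi, generic phi & forall i, chips phi i < 0).
Proof.
have [rho inj rhoP] := burning_order sup_feasible_burn.
have [q_ge0|q_lt0] := leP 0 (chips sup_feasible q).
  left; exists sup_feasible => i.
  by have [->//|] := eqVneq i q; apply: feasible_sup.2.
right; have [d d0 dP] := offset_perturb sup_feasible (fun l => (rho l)%:R).
have {}dP := dP (d / 2); exists (fun l => sup_feasible l + d / 2 * (rho l)%:R).
  move=> i j ij; have [|_ ->] := dP _ i j; first by apply/andP; split; lra.
  by rewrite eqr_nat (inj_eq inj) eq_sym (negbTE ij).
move=> i; rewrite /chips; under eq_bigr => j _.
  have [|-> _] := dP _ i j; first by apply/andP; split; lra.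
  over.
rewrite sumrB addrA -/(chips _ i) subr_lt0 -(big_morph Posz PoszD (erefl 0%Z)).
have [->|iq] := eqVneq i q; first exact: lt_le_trans q_lt0 _.
apply: lt_le_trans (rhoP i iq) _.
rewrite lez_nat -sum1dep_card [leqLHS]big_mkcond leq_sum // => j _.
by rewrite ltr_nat; case: (_ && _).
Qed.

End Reduced.
End Chips.

(** * Rational functions on metric graphs *)

Section Slopes.
Variables (R : realType) (G : metric_graph R).
Implicit Types (f g : point G -> R) (e : edge G).

Lemma edge_point0 e : edge_point e 0 = inl (src e).
Proof. by rewrite /edge_point insubF ?lexx //= ltxx. Qed.

Lemma edge_point_len e : edge_point e (len e) = inl (tgt e).
Proof. by rewrite /edge_point insubF ?leNgt ?len_gt0 //= ltxx andbF. Qed.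

Lemma edge_point_val (x : edge_interior G) :
  edge_point (val x).1 (val x).2 = inr x.
Proof. by rewrite /edge_point -surjective_pairing valK. Qed.

Lemma edge_point_interior e t : 0 < t < len e ->
  exists2 x : edge_interior G, edge_point e t = inr x & val x = (e, t).
Proof.
by move=> t_in; rewrite /edge_point insubT; exists (Sub (e, t) t_in).
Qed.

Definition slope f e (t sg : R) (s : int) := exists2 d : R, 0 < d &
  forall eps : R, 0 < eps < d ->
    f (edge_point e t) - f (edge_point e (t + sg * eps)) = s%:~R * eps.

Lemma slope_uniq f e t sg s1 s2 :
  slope f e t sg s1 -> slope f e t sg s2 -> s1 = s2.
Proof.
move=> [d1 d1_gt0 f1] [d2 d2_gt0 f2].
have [r /andP[r_gt0 /andP[r_lt1 r_lt2]]] :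
    exists r, (0 < r) && ((r < d1) && (r < d2)).
  have [d12|d21] := leP d1 d2.
    by exists (d1 / 2); rewrite divr_gt0 //=; apply/andP; split; lra.
  by exists (d2 / 2); rewrite divr_gt0 //=; apply/andP; split; lra.
have := f1 r; rewrite f2 ?r_gt0 // => /(_ r_lt1) /(mulIf (lt0r_neq0 r_gt0)).
by move/intr_inj.
Qed.

Lemma incoming_slopeE f e t sg s :
  slope f e t sg s -> incoming_slope f e t sg = s.
Proof.
move=> fs; apply: (@slope_uniq f e t sg) (fs).
by rewrite /incoming_slope; case: xgetP => [y _ //|/(_ s)].
Qed.

Lemma slopeB f g e t sg s1 s2 : slope f e t sg s1 -> slope g e t sg s2 ->
  slope (fun p => f p - g p) e t sg (s1 - s2).
Proof.
move=> [d1 d1_gt0 f1] [d2 d2_gt0 f2]; exists (Num.min d1 d2).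
  by rewrite lt_min d1_gt0.
move=> eps /andP[eps_gt0]; rewrite lt_min => /andP[lt1 lt2].
by rewrite intrB mulrBl -f1 ?eps_gt0 // -f2 ?eps_gt0 //; lra.
Qed.

(** A local substitute for [rational], equivalent to it by the lemmas below; it passes to
    differences without a common subdivision. *)
Definition has_slopes f := forall e t,
  (0 <= t < len e -> exists s, slope f e t 1 s) /\
  (0 < t <= len e -> exists s, slope f e t (-1) s).

Lemma has_slopesB f g :
  has_slopes f -> has_slopes g -> has_slopes (fun p => f p - g p).
Proof.
move=> fS gS e t; split=> tin.
  have [[s1 f1] [s2 g2]] := ((fS e t).1 tin, (gS e t).1 tin).
  by exists (s1 - s2); apply: slopeB.
have [[s1 f1] [s2 g2]] := ((fS e t).2 tin, (gS e t).2 tin).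
by exists (s1 - s2); apply: slopeB.
Qed.

Lemma div_coeffB f g p : has_slopes f -> has_slopes g ->
  div_coeff (fun p => f p - g p) p = div_coeff f p - div_coeff g p.
Proof.
move=> fS gS.
have inB e t sg : (exists s, slope f e t sg s) -> (exists s, slope g e t sg s) ->
    incoming_slope (fun p => f p - g p) e t sg =
    incoming_slope f e t sg - incoming_slope g e t sg.
  move=> [s1 f1] [s2 g2].
  by rewrite (incoming_slopeE f1) (incoming_slopeE g2) (incoming_slopeE (slopeB f1 g2)).
case: p => [v|x] /=.
  rewrite opprD addrACA -!sumrB; congr (_ + _); apply: eq_bigr => e _; apply: inB.
  - by apply: (fS e 0).1; rewrite lexx len_gt0.
  - by apply: (gS e 0).1; rewrite lexx len_gt0.
  - by apply: (fS e (len e)).2; rewrite lexx len_gt0.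
  - by apply: (gS e (len e)).2; rewrite lexx len_gt0.
have /andP[x0 x1] := valP x.
rewrite opprD addrACA; congr (_ + _); apply: inB.
- by apply: (fS _ _).1; rewrite x1 ltW.
- by apply: (gS _ _).1; rewrite x1 ltW.
- by apply: (fS _ _).2; rewrite x0 ltW.
- by apply: (gS _ _).2; rewrite x0 ltW.
Qed.

Definition subdivided f e (y : R) (n : nat) (t : nat -> R) (m : nat -> int) :=
  [/\ t 0%N = 0, t n = y, forall i, (i < n)%N -> t i < t i.+1 &
    forall i x, (i < n)%N -> t i <= x <= t i.+1 ->
      f (edge_point e x) = f (edge_point e (t i)) + (m i)%:~R * (x - t i)].

Lemma subdivided_right f e y n t m i x : subdivided f e y n t m -> (i < n)%N ->
  t i <= x < t i.+1 -> slope f e x 1 (- m i).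
Proof.
move=> [_ _ _ aff] i_n /andP[ix xi]; exists (t i.+1 - x); first by rewrite subr_gt0.
move=> eps /andP[eps0 lt].
rewrite (aff i x) ?ix ?ltW // (aff i (x + 1 * eps)) //; last by apply/andP; split; lra.
by rewrite intrN; ring.
Qed.

Lemma subdivided_left f e y n t m i x : subdivided f e y n t m -> (i < n)%N ->
  t i < x <= t i.+1 -> slope f e x (-1) (m i).
Proof.
move=> [_ _ _ aff] i_n /andP[ix xi]; exists (x - t i); first by rewrite subr_gt0.
move=> eps /andP[eps0 lt].
rewrite (aff i x) ?xi ?ltW // (aff i (x + -1 * eps)) //; last by apply/andP; split; lra.
by ring.
Qed.

Lemma rational_has_slopes f : rational f -> has_slopes f.
Proof.
move=> fR e x; have [n [t [m sub]]] := fR e; have [t0 tn _ _] := sub.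
rewrite -tn; split=> [/andP[x0 xn]|/andP[x0 xn]].
  have [i i_n tx] : exists2 i, (i < n)%N & t i <= x < t i.+1.
    move: x0 xn; rewrite -t0; elim: n {sub tn} => [|n IH] x0 xn.
      by have := le_lt_trans x0 xn; rewrite ltxx.
    have [nx|xn'] := leP (t n) x; first by exists n; rewrite ?nx.
    by have [i i_n tx] := IH x0 xn'; exists i; rewrite // ltnW.
  by exists (- m i); apply: subdivided_right sub i_n tx.
have [i i_n tx] : exists2 i, (i < n)%N & t i < x <= t i.+1.
  move: x0 xn; rewrite -t0; elim: n {sub tn} => [|n IH] x0 xn.
    by have := lt_le_trans x0 xn; rewrite ltxx.
  have [xn'|nx] := leP x (t n); last by exists n; rewrite ?nx.
  by have [i i_n tx] := IH x0 xn'; exists i; rewrite // ltnW.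
by exists (m i); apply: subdivided_left sub i_n tx.
Qed.

(** Compactness of the edge, through the supremum of the lengths up to which [f] can be subdivided:
    the slope on its left shows that it is reached, the slope on its right that it is the whole
    length. *)
Lemma has_slopes_rational f : has_slopes f -> rational f.
Proof.
move=> fS e; pose P y := exists n t m, subdivided f e y n t m.
change (P (len e)).
have P0 : P 0 by exists 0%N, (fun=> 0), (fun=> 0); split.
have ext y y' (s : int) : P y -> y < y' -> (forall x, y <= x <= y' ->
    f (edge_point e x) = f (edge_point e y) + s%:~R * (x - y)) -> P y'.
  move=> [n [t [m [t0 tn incr aff]]]] yy' affy.
  exists n.+1, (fun i => if (i <= n)%N then t i else y'),
    (fun i => if (i < n)%N then m i else s); split=> [//||i|i x].
  - by rewrite ltnn.
  - rewrite ltnS => i_n; rewrite i_n.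
    by case: ltngtP i_n => // [/incr//|-> _]; rewrite tn.
  - rewrite ltnS => i_n; rewrite i_n.
    case: ltngtP i_n => // [i_n _|-> _]; first exact: aff.
    by rewrite tn; apply: affy.
pose A := [set y | 0 <= y <= len e /\ P y]%classic.
have A0 : A 0 by split=> //; rewrite lexx ltW ?len_gt0.
have supA : has_sup A.
  by split; [exists 0 | exists (len e) => y [/andP[_ yl] _]].
set s := sup A; have s_ge0 : 0 <= s by apply: ub_le_sup => //; case: supA.
have s_le : s <= len e by apply: ge_sup => [|y [/andP[]]//]; exists 0.
have Ps : P s.
  move: s_ge0; rewrite le_eqVlt => /orP[/eqP<-//|s_gt0].
  have [|c [d d0 fd]] := (fS e s).2; first by rewrite s_gt0.
  have [y Ay] := sup_adherent d0 supA; rewrite -/s => sdy.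
  have [/andP[y0 yl] Py] := Ay.
  have : y <= s by apply: ub_le_sup => //; case: supA.
  rewrite le_eqVlt => /orP[/eqP<-//|ys].
  have fE x : s - d < x <= s ->
      f (edge_point e x) = f (edge_point e s) - c%:~R * (s - x).
    move=> /andP[dx]; rewrite le_eqVlt => /orP[/eqP->|xs]; first by ring.
    have := fd (s - x); have -> : s + -1 * (s - x) = x by ring.
    by move=> <-; [ring | apply/andP; split; lra].
  apply: (ext y s c) => // x /andP[yx xs].
  by rewrite fE ?(fE y); [ring | apply/andP; split; lra..].
move: s_le; rewrite le_eqVlt => /orP[/eqP<-//|s_lt].
have [|c [d d0 fd]] := (fS e s).1; first by rewrite s_ge0.
have [d' [d'0 d'd sd']] : exists d', [/\ 0 < d', d' < d & s + d' <= len e].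
  have [le|le] := leP (d / 2) (len e - s).
    by exists (d / 2); split; lra.
  by exists (len e - s); split; lra.
suff /(ub_le_sup (proj2 supA)) : A (s + d') by rewrite -/s; lra.
split; first by apply/andP; split; lra.
apply: (ext s _ (- c)) => // [|x /andP[]]; first by lra.
rewrite le_eqVlt => /orP[/eqP<- _|sx xd]; first by ring.
have := fd (x - s); have -> : s + 1 * (x - s) = x by ring.
by move=> fx; rewrite intrN mulNr -fx; [ring | apply/andP; split; lra].
Qed.

(** The slopes can increase only at [p], and there by at most one. Starting at -1 or less, they stay
    nonpositive, and the first piece is strictly decreasing. *)
Lemma drop_of_first_slope (n : nat) (p : R) (t F : nat -> R) (m : nat -> int) :
    (forall i, (i < n)%N -> t i < t i.+1) ->
    (forall i, (i < n)%N -> F i.+1 = F i + (m i)%:~R * (t i.+1 - t i)) ->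
    (forall i, (i.+1 < n)%N -> m i.+1 <= m i + (t i.+1 == p)%:Z) ->
  (0 < n)%N -> m 0%N < 0 -> F n < F 0%N.
Proof.
move=> incr step conc n_gt0 m0.
have m_le i : (i < n)%N -> m i <= -1 + (p <= t i)%R%:Z.
  elim: i => [_|i IH i_n]; first by case: (p <= t 0%N); lia.
  have lt := incr i (ltnW i_n); apply: le_trans (conc i i_n) _.
  have {IH} := IH (ltnW i_n); have [pi|ip] := leP p (t i).
    by rewrite (gt_eqF (le_lt_trans pi lt)) (ltW (le_lt_trans pi lt)) addr0.
  case: eqP => [->|_] mi; first by rewrite lexx lerD2r (le_trans mi).
  by apply: le_trans (_ : -1 <= _); rewrite ?lerDl // addr0 (le_trans mi).
have : forall i, (i < n)%N -> F i.+1 < F 0%N.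
  elim=> [n0|i IH i_n].
    have := incr 0%N n0; rewrite step // -(ltr_int R) in m0 *; nra.
  have m_le0 : (m i.+1)%:~R <= 0 :> R.
    by rewrite (ler_int R _ 0); have := m_le _ i_n; case: (p <= _); lia.
  have := IH (ltnW i_n); have := incr _ i_n; rewrite (step i.+1) //; nra.
by case: n n_gt0 {incr step conc m_le} => // n _; apply.
Qed.

(** The previous lemma with the edge traversed backwards. *)
Lemma rise_of_last_slope (n : nat) (p : R) (t F : nat -> R) (m : nat -> int) :
    (forall i, (i < n)%N -> t i < t i.+1) ->
    (forall i, (i < n)%N -> F i.+1 = F i + (m i)%:~R * (t i.+1 - t i)) ->
    (forall i, (i.+1 < n)%N -> m i.+1 <= m i + (t i.+1 == p)%:Z) ->
  (0 < n)%N -> 0 < m n.-1 -> F 0%N < F n.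
Proof.
move=> incr step conc n_gt0 mn.
rewrite -[X in F X < _](subnn n) -[X in _ < F X](subn0 n).
apply: (@drop_of_first_slope n (- p) (fun i => - t (n - i)%N)
  (fun i => F (n - i)%N) (fun i => - m (n - i.+1)%N)) => // [i i_n|i i_n|i i_n|].
- by rewrite ltrN2 -(subnSK i_n) incr // subnSK // leq_subr.
- by rewrite -(subnSK i_n) step ?intrN; [ring | rewrite subnSK ?leq_subr].
- rewrite eqr_opp; have := conc (n - i.+2)%N.
  rewrite subnSK // ltn_subrL n_gt0 => /(_ isT).
  by move: (nat_of_bool _) (m (n - i.+1)%N) (m (n - i.+2)%N) => b x y; clear; lia.
- by rewrite subn1 oppr_lt0.
Qed.

(* A vertex [v] minimizing [f] among the vertices needs a positive incoming slope;
   along that edge the slope can change sign nowhere, since the only chip of [N]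
   in its interior shifts the slope by one. *)
Lemma not_equiv_effective (N E : divisor G) f (v0 : vertex G) :
    (forall v, coeff (inl v) N < 0) ->
    (forall e, exists p, forall t, 0 < t < len e ->
       coeff (edge_point e t) N <= (t == p)%:Z) ->
  effective E -> rational f -> ~ is_principal f (E - N).
Proof.
move=> Nv Ne E_ge0 fR fdiv.
have [v _ v_min] :=
  @Order.TotalTheory.arg_minP _ _ _ v0 xpredT (fun v => f (inl v)) isT.
have {}fdiv q : - coeff q N <= div_coeff f q.
  by rewrite -fdiv coeffB lerDr E_ge0.
have edgeP e : exists n p m (t F : nat -> R),
    [/\ (0 < n)%N, F 0%N = f (inl (src e)), F n = f (inl (tgt e)),
        incoming_slope f e 0 1 = - m 0%N & incoming_slope f e (len e) (-1) = m n.-1] /\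
    [/\ forall i, (i < n)%N -> t i < t i.+1,
    forall i, (i < n)%N -> F i.+1 = F i + (m i)%:~R * (t i.+1 - t i) &
    forall i, (i.+1 < n)%N -> m i.+1 <= m i + (t i.+1 == p)%:Z].
  have [n [t [m sub]]] := fR e; have [p Np] := Ne e.
  have [t0 tn incr aff] := sub.
  have n_gt0 : (0 < n)%N.
    by case: (n) tn => // t0'; have := len_gt0 e; rewrite -t0' t0 ltxx.
  have t_lt i j : (i < j)%N -> (j <= n)%N -> t i < t j.
    elim: j => // j IH; rewrite ltnS leq_eqVlt => /orP[/eqP->|ij] jn; first exact: incr.
    by apply: lt_trans (incr _ jn); apply: IH => //; apply: ltnW.
  exists n, p, m, t, (fun i => f (edge_point e (t i))); split; split=> //.
  - by rewrite t0 edge_point0.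
  - by rewrite tn edge_point_len.
  - apply/incoming_slopeE/(subdivided_right sub) => //.
    by rewrite t0 lexx -t0 incr.
  - apply/incoming_slopeE/(subdivided_left sub); first by rewrite prednK.
    by rewrite prednK // tn lexx andbT -tn t_lt // prednK.
  - by move=> i i_n; rewrite (aff i _ i_n) // lexx ltW ?incr.
  (* At a breakpoint the incoming slopes are [m i] and [- m i.+1], so the lower bound on the divisor
     limits the increase of the slope. *)
  - move=> i i_n; have ti : 0 < t i.+1 < len e by rewrite -t0 -tn !t_lt //= ltnW.
    have [x xE val_x] := edge_point_interior ti.
    have := fdiv (edge_point e (t i.+1)); have := Np _ ti.
    rewrite xE /= val_x /=.
    rewrite (incoming_slopeE (subdivided_right sub i_n _)) ?lexx ?incr //.
    rewrite (incoming_slopeE (subdivided_left sub (ltnW i_n) _)) ?lexx ?andbT ?incr //.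
      move: (coeff _ N) (nat_of_bool _) (m i) (m i.+1) => c b x1 x2.
      by clear; lia.
    exact: ltnW.
have := fdiv (inl v); rewrite /= => /(lt_le_trans _) => /(_ 0).
rewrite oppr_gt0 Nv => /(_ isT).
have [src_le0|/existsNP[e /not_implyP[/eqP se /negP]]] :=
  pselect (forall e, src e == v -> incoming_slope f e 0 1 <= 0).
  have [tgt_le0|/existsNP[e /not_implyP[/eqP te /negP]]] :=
    pselect (forall e, tgt e == v -> incoming_slope f e (len e) (-1) <= 0).
    by rewrite ltNge -[leRHS](addr0 0) lerD ?sumr_le0.
  rewrite -ltNge => sl _.
  have [n [p [m [t [F [[n_gt0 F0 Fn _ mn] [incr step conc]]]]]]] := edgeP e.
  have := rise_of_last_slope incr step conc n_gt0; rewrite -mn => /(_ sl).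
  by rewrite F0 Fn te ltNge v_min.
rewrite -ltNge => sl _.
have [n [p [m [t [F [[n_gt0 F0 Fn m0 _] [incr step conc]]]]]]] := edgeP e.
have := drop_of_first_slope incr step conc n_gt0; rewrite -oppr_gt0 -m0 => /(_ sl).
by rewrite F0 Fn se ltNge v_min.
Qed.

End Slopes.

(** * Normal forms of divisors on complete graphs *)

Section Pairing.
Variables (K : choiceType) (V : zmodType).
Implicit Types (D E : {freeg K / int}) (F : K -> V).

(** The additive extension of [F] to divisors. Coefficients, degrees, masses and moments are all of
    this form, so their additivity is proved once. *)
Definition pairing F D : V := \sum_(p <- dom D) F p *~ coeff p D.

Lemma pairing_widen F D s : uniq s -> {subset dom D <= s} ->
  pairing F D = \sum_(p <- s) F p *~ coeff p D.
Proof.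
move=> s_uniq sub; rewrite (bigID (mem (dom D))) /= addrC big1 ?add0r.
  rewrite -big_filter; apply: perm_big; apply: uniq_perm.
  - exact: uniq_dom.
  - exact: filter_uniq.
  - by move=> p; rewrite mem_filter andb_idr // => /sub.
by move=> p pD; rewrite coeff_outdom // mulr0z.
Qed.

Lemma pairingB F D E : pairing F (D - E) = pairing F D - pairing F E.
Proof.
have s_uniq := undup_uniq (dom D ++ dom E).
rewrite !(pairing_widen F s_uniq); last 3 first.
- by move=> p pE; rewrite mem_undup mem_cat pE orbT.
- by move=> p pD; rewrite mem_undup mem_cat pD.
- by move=> p /domB; rewrite mem_undup.
by rewrite -sumrB; apply: eq_bigr => p _; rewrite coeffB mulrzBr.
Qed.

Lemma pairing_eq0 F D : (forall p, F p = 0 \/ coeff p D = 0) -> pairing F D = 0.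
Proof.
by move=> FD; apply: big1 => p _; case: (FD p) => ->; rewrite ?mul0rz ?mulr0z.
Qed.

Lemma pairing_sum (I : finType) (F : I -> K -> V) D :
  pairing (fun p => \sum_i F i p) D = \sum_i pairing (F i) D.
Proof. by rewrite exchange_big; apply: eq_bigr => p _; rewrite mulrz_suml. Qed.

Lemma pairingDl F F' D :
  pairing (fun p => F p + F' p) D = pairing F D + pairing F' D.
Proof. by rewrite -big_split; apply: eq_bigr => p _; rewrite /= mulrzDl. Qed.

End Pairing.

Lemma coeff_pairing (K : choiceType) (D : {freeg K / int}) q :
  coeff q D = pairing (fun p => (p == q)%:Z) D.
Proof.
have s_uniq : uniq (undup (q :: dom D)) by exact: undup_uniq.
rewrite (pairing_widen _ s_uniq) => [|p pD]; last by rewrite mem_undup inE pD orbT.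
rewrite (bigD1_seq q) ?mem_undup ?mem_head //= eqxx intz big1 ?addr0 //.
by move=> p /negbTE->; rewrite mul0rz.
Qed.

Lemma deg_pairing (K : choiceType) (D : {freeg K / int}) :
  deg D = pairing (fun=> 1) D.
Proof.
rewrite -{1}(freeg_sumE D) (raddf_sum (@deg K)); apply: eq_bigr => p _.
by rewrite /= degU intz.
Qed.

Lemma pairing_le (K : choiceType) (V : numDomainType) (F F' : K -> V)
    (D : {freeg K / int}) :
    (forall p, 0 <= coeff p D) -> (forall p, F p <= F' p) ->
  pairing F D <= pairing F' D.
Proof.
move=> D_ge0 FF'; apply: ler_sum => p _; have := D_ge0 p.
by case: (coeff p D) => // n _; rewrite -!pmulrn lerMn2r FF' orbT.
Qed.

(** * One-sided slopes of functions of the edge parameter *)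

Section LocalSlope.
Variable R : realType.
Implicit Types (h : R -> R) (x y sg : R).

Definition local_slope h x sg (s : int) := exists2 d : R, 0 < d &
  forall eps : R, 0 < eps < d -> h x - h (x + sg * eps) = s%:~R * eps.

Lemma local_slopeD h h' x sg s s' : local_slope h x sg s ->
  local_slope h' x sg s' -> local_slope (fun y => h y + h' y) x sg (s + s').
Proof.
move=> [d1 d1_gt0 h1] [d2 d2_gt0 h2]; exists (Num.min d1 d2).
  by rewrite lt_min d1_gt0.
move=> eps /andP[eps_gt0]; rewrite lt_min => /andP[lt1 lt2].
by rewrite intrD mulrDl -h1 ?eps_gt0 // -h2 ?eps_gt0 //; lra.
Qed.

Lemma local_slopeMz h x sg s (c : int) : local_slope h x sg s ->
  local_slope (fun y => h y *~ c) x sg (s *~ c).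
Proof.
move=> [d d_gt0 hd]; exists d => // eps /hd.
by rewrite -mulrzBl => ->; rewrite mulrzz intrM -mulrzl; ring.
Qed.

Lemma local_slope0 x sg : local_slope (fun=> 0) x sg 0.
Proof. by exists 1 => // eps _; rewrite subrr mul0r. Qed.

Lemma local_slope_pairing (K : choiceType) (F : K -> R -> R) (S : K -> int)
    (D : {freeg K / int}) x sg :
    (forall p, local_slope (F p) x sg (S p)) ->
  local_slope (fun y => pairing (fun p => F p y) D) x sg (pairing S D).
Proof.
move=> FS; rewrite /pairing; elim: (dom D) => [|p s IH].
  rewrite big_nil; have -> : (fun y => \sum_(p <- [::]) F p y *~ coeff p D) = fun=> 0.
    by apply/funext => y; rewrite big_nil.
  exact: local_slope0.
rewrite big_cons; have -> : (fun y => \sum_(p <- p :: s) F p y *~ coeff p D) =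
    fun y => F p y *~ coeff p D + \sum_(p <- s) F p y *~ coeff p D.
  by apply/funext => y; rewrite big_cons.
by apply: local_slopeD => //; apply: local_slopeMz.
Qed.

(** The weak inequality here, against the strict one on the left, records that a kink at [x] itself
    is felt only to the right. *)
Lemma local_slope_hinge_right x y :
  local_slope (fun z => Num.max 0 (z - y)) x 1 (- (y <= x)%R%:Z).
Proof.
have [yx|xy] := leP y x.
  exists 1 => // eps /andP[eps0 _].
  by rewrite !max_r /= ?intrN ?mulr1z; [ring | lra..].
exists (y - x); first by rewrite subr_gt0.
by move=> eps /andP[eps0 lt]; rewrite !max_l ?mul0r; [ring | lra..].
Qed.

Lemma local_slope_hinge_left x y :
  local_slope (fun z => Num.max 0 (z - y)) x (-1) (y < x)%R%:Z.
Proof.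
have [yx|xy] := ltP y x.
  exists (x - y); first by rewrite subr_gt0.
  move=> eps /andP[eps0 lt].
  by rewrite !max_r /= ?mulr1z; [ring | lra..].
exists 1 => // eps /andP[eps0 lt].
by rewrite !max_l /= ?oppr0 ?mul0r; [ring | lra..].
Qed.

Lemma local_slope_affine (a : R) (m sg : int) x :
  local_slope (fun z => a + m%:~R * z) x sg%:~R (- (m * sg)).
Proof. by exists 1 => // eps _; rewrite intrN intrM; ring. Qed.

End LocalSlope.

Section CompleteGraph.
Variables (R : realType) (d : nat).
Local Notation K := (complete_metric_graph R d).
Implicit Types (D E : divisor K) (phi : 'I_d -> R) (i j v : 'I_d).

Definition ends (e : edge K) : 'I_d * 'I_d :=
  sval (e : {e : 'I_d * 'I_d | (e.1 < e.2)%N}).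

Lemma ends_lt (e : edge K) : ((ends e).1 < (ends e).2)%N.
Proof. exact: (svalP (e : {e : 'I_d * 'I_d | (e.1 < e.2)%N})). Qed.

Definition on_edge (V : zmodType) i j (F : R -> V) (p : point K) : V :=
  if p is inr x then if ends (val x).1 == (i, j) then F (val x).2 else 0
  else 0.

(* [mass D i j] and [moment D i j] vanish unless [i < j], see [mass0]. *)
Definition mass D i j : int := pairing (on_edge i j (fun=> 1)) D.
Definition moment D i j : R := pairing (on_edge i j (fun x => 1 - x)) D.
(** Chips inside an edge are counted at its larger end; [shift] remembers the total distance by
    which they were moved, 1 - x for each. *)
Definition base D i := coeff (inl i : point K) D + \sum_j mass D j i.
Definition shift D i j := moment D i j - moment D j i.

Definition chips_of D := chips (base D) (shift D).
Definition slope_of D phi i j := Num.floor (offset (shift D) phi i j).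
(** The value 1 stands for an integral offset, when no chip lies inside the edge. *)
Definition chip_pos D phi i j :=
  1 - (offset (shift D) phi i j - (slope_of D phi i j)%:~R).

Lemma shiftN D i j : shift D i j = - shift D j i.
Proof. by rewrite /shift opprB. Qed.

Lemma on_edge0 (V : zmodType) i j (F : R -> V) p : (j <= i)%N -> on_edge i j F p = 0.
Proof.
rewrite leqNgt => ij; case: p => //= x; case: eqP => // xij.
by have := ends_lt (val x).1; rewrite xij (negbTE ij).
Qed.

Lemma mass0 D i j : (j <= i)%N -> mass D i j = 0.
Proof. by move=> ij; apply: pairing_eq0 => p; left; apply: on_edge0. Qed.

Lemma moment0 D i j : (j <= i)%N -> moment D i j = 0.
Proof. by move=> ij; apply: pairing_eq0 => p; left; apply: on_edge0. Qed.

Lemma shift_lt D i j : (i < j)%N -> shift D i j = moment D i j.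
Proof. by move=> ij; rewrite /shift (moment0 D (ltnW ij)) subr0. Qed.

Lemma chip_pos_itv D phi i j : 0 < chip_pos D phi i j <= 1.
Proof.
have := floor_itv (offset (shift D) phi i j); rewrite intrD -/(slope_of _ _ _ _).
by rewrite /chip_pos => /andP[]; set x := offset _ _ _ _; move=> *; apply/andP; split; lra.
Qed.

Lemma chip_pos_lt1 D phi i j :
  (chip_pos D phi i j < 1) = (offset (shift D) phi i j \isn't a Num.int).
Proof.
rewrite intrEfloor -/(slope_of _ _ _ _) gtrBl subr_gt0 lt_neqAle.
by rewrite floor_le andbT.
Qed.

Lemma sum_edge_src (V : zmodType) (H : 'I_d * 'I_d -> V) v :
  \sum_(e : edge K | src e == v) H (ends e) = \sum_(j : 'I_d | (v < j)%N) H (v, j).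
Proof.
rewrite (reindex_omap (fun e : edge K => (ends e).2)
  (fun j => insub (v, j) : option {e : 'I_d * 'I_d | (e.1 < e.2)%N})) /=.
  apply: eq_big => [e|e /eqP <-]; last by rewrite -surjective_pairing.
  apply/eqP/idP => [<-|/andP[vj]].
    rewrite ends_lt -surjective_pairing /=.
    by have := valK (e : {e : 'I_d * 'I_d | (e.1 < e.2)%N}) => /= ->.
  by rewrite insubT => /eqP[<-].
by move=> j vj; rewrite insubT.
Qed.

Lemma sum_edge_tgt (V : zmodType) (H : 'I_d * 'I_d -> V) v :
  \sum_(e : edge K | tgt e == v) H (ends e) = \sum_(j : 'I_d | (j < v)%N) H (j, v).
Proof.
rewrite (reindex_omap (fun e : edge K => (ends e).1)
  (fun j => insub (j, v) : option {e : 'I_d * 'I_d | (e.1 < e.2)%N})) /=.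
  apply: eq_big => [e|e /eqP <-]; last by rewrite -surjective_pairing.
  apply/eqP/idP => [<-|/andP[vj]].
    rewrite ends_lt -surjective_pairing /=.
    by have := valK (e : {e : 'I_d * 'I_d | (e.1 < e.2)%N}) => /= ->.
  by rewrite insubT => /eqP[<-].
by move=> j vj; rewrite insubT.
Qed.

(** Splits the sum by orientation, to match the two sums of [div_coeff]. At a target end, the floor
    of a negated offset gives up one more chip when the edge has one inside. *)
Lemma chips_ofE D phi v : chips_of D phi v = coeff (inl v : point K) D
  + \sum_(j : 'I_d | (v < j)%N) slope_of D phi v j
  + \sum_(j : 'I_d | (j < v)%N) (mass D j v - slope_of D phi j v
                         - (chip_pos D phi j v < 1)%R%:Z).
Proof.
rewrite /chips_of /chips /base -!addrA; congr (_ + _).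
rewrite -big_split [in RHS]big_mkcond [X in _ = _ + X]big_mkcond -big_split.
apply: eq_bigr => j _ /=; case: ltngtP => [vj|jv|/val_inj->].
- by rewrite mass0 ?add0r ?addr0 // ltnW.
- rewrite add0r -addrA; congr (_ + _).
  by rewrite offsetC ?floorNnint ?chip_pos_lt1 //; apply: shiftN.
- by rewrite mass0 // offset_diag ?floor0 ?addr0 //; apply: shiftN.
Qed.

(** Every point is counted exactly once, an interior one at the larger end of its edge. *)
Lemma sum_base D : \sum_i base D i = deg D.
Proof.
rewrite deg_pairing big_split /=.
under eq_bigr do rewrite coeff_pairing.
under [X in _ + X]eq_bigr do rewrite -pairing_sum.
rewrite -!pairing_sum -pairingDl; apply: eq_bigr => p _; congr (_ *~ _).
case: p => [v|x].
  rewrite (bigD1 v) //= eqxx big1 ?addr0 => [|i iv]; last first.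
    by case: eqP => // -[vi]; rewrite vi eqxx in iv.
  by rewrite big1 ?addr0 // => i _; rewrite big1.
rewrite big1 ?add0r // (bigD1 (ends (val x).1).2) //= (bigD1 (ends (val x).1).1) //=.
rewrite -surjective_pairing eqxx big1 ?addr0 => [|i ix]; last first.
  by case: eqP => // xi; move: ix; rewrite xi eqxx.
rewrite big1 ?addr0 // => j jx; rewrite big1 // => i _.
by case: eqP => // xj; move: jx; rewrite xj eqxx.
Qed.

(* The second derivative of [edge_fun] inside the edge is [D] minus one chip at
   [chip_pos]; the initial slope and [chip_pos] are the integral and fractional
   parts that make it end at [- phi j]. *)
Definition edge_fun D phi i j (x : R) : R :=
  - phi i + (- slope_of D phi i j)%:~R * x
  + pairing (fun p => on_edge i j (fun y => Num.max 0 (x - y)) p) D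
  + Num.max 0 (x - chip_pos D phi i j) *~ (-1).

Definition potential D phi (p : point K) : R := match p with
  | inl v => - phi v
  | inr x => let e := ends (val x).1 in edge_fun D phi e.1 e.2 (val x).2
  end.

(** Continuity of [potential]: the formula for the interior also gives the prescribed values at both
    ends. *)
Lemma potential_edge D phi (e : edge K) x : 0 <= x <= 1 ->
  potential D phi (edge_point e x) = edge_fun D phi (ends e).1 (ends e).2 x.
Proof.
move=> /andP[]; rewrite le_eqVlt => /orP[/eqP<-|x0].
  rewrite edge_point0 /= /edge_fun.
  have /andP[pos0 _] := chip_pos_itv D phi (ends e).1 (ends e).2.
  rewrite max_l; last by lra.
  rewrite pairing_eq0 => [|[v|y]] /=; first by rewrite /ends /=; lra.
    by left.
  left; case: eqP => // _; have /andP[y0 _] := valP y.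
  by rewrite max_l // sub0r oppr_le0 ltW.
rewrite le_eqVlt => /orP[/eqP->|x1]; last first.
  have [|y -> yE] := @edge_point_interior _ K e x; first by rewrite x0.
  by rewrite /= yE.
have -> : edge_point e 1 = inl (tgt e) by exact: (@edge_point_len _ K).
rewrite /= /edge_fun.
have /andP[_ pos1] := chip_pos_itv D phi (ends e).1 (ends e).2.
rewrite max_r; last by lra.
have -> : pairing (on_edge (ends e).1 (ends e).2 (fun y => Num.max 0 (1 - y))) D =
    moment D (ends e).1 (ends e).2.
  apply: eq_bigr => p _; congr (_ *~ _); case: p => //= y; case: eqP => // _.
  by have /andP[_ y1] := valP y; rewrite max_r // subr_ge0 ltW.
rewrite /chip_pos intrN mulrN1z /offset (shift_lt _ (ends_lt e)) /=.
set m := (_)%:~R; rewrite -/(ends e); lra.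
Qed.

Lemma on_edge_local_slope i j (F : R -> R -> R) (S : R -> int) x sg p :
    (forall y, local_slope (fun z => F z y) x sg (S y)) ->
  local_slope (fun z => on_edge i j (F z) p) x sg (on_edge i j S p).
Proof.
move=> FS; case: p => [v|y] /=; first exact: local_slope0.
by case: ifP => _; [apply: FS | apply: local_slope0].
Qed.

Definition right_slope D phi i j x : int := slope_of D phi i j
  + pairing (on_edge i j (fun y => - (y <= x)%R%:Z)) D
  + (chip_pos D phi i j <= x)%R%:Z.

Definition left_slope D phi i j x : int := - slope_of D phi i j
  + pairing (on_edge i j (fun y => (y < x)%R%:Z)) D
  - (chip_pos D phi i j < x)%R%:Z.

Lemma potential_right_slope D phi (e : edge K) x : 0 <= x < 1 ->
  slope (potential D phi) e x 1 (right_slope D phi (ends e).1 (ends e).2 x).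
Proof.
move=> /andP[x0 x1]; set i := (ends e).1; set j := (ends e).2.
have [r r0 hr] : local_slope (edge_fun D phi i j) x 1 (right_slope D phi i j x).
  have -> : right_slope D phi i j x = - (- slope_of D phi i j * 1)
      + pairing (on_edge i j (fun y => - (y <= x)%R%:Z)) D
      + (- (chip_pos D phi i j <= x)%R%:Z) *~ (-1).
    by rewrite mulrN1z opprK mulr1 opprK.
  apply: local_slopeD; last first.
    exact/(@local_slopeMz _ (fun z => _))/local_slope_hinge_right.
  apply: local_slopeD; first exact: (@local_slope_affine _ _ _ 1).
  by apply: local_slope_pairing => p; apply/on_edge_local_slope/local_slope_hinge_right.
exists (Num.min r (1 - x)); first by rewrite lt_min r0 subr_gt0.
move=> eps /andP[eps0]; rewrite lt_min => /andP[epsr eps1].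
by rewrite !potential_edge ?hr ?eps0 //; apply/andP; split; lra.
Qed.

Lemma potential_left_slope D phi (e : edge K) x : 0 < x <= 1 ->
  slope (potential D phi) e x (-1) (left_slope D phi (ends e).1 (ends e).2 x).
Proof.
move=> /andP[x0 x1]; set i := (ends e).1; set j := (ends e).2.
have [r r0 hr] : local_slope (edge_fun D phi i j) x (-1) (left_slope D phi i j x).
  have -> : left_slope D phi i j x = - (- slope_of D phi i j * -1)
      + pairing (on_edge i j (fun y => (y < x)%R%:Z)) D
      + (chip_pos D phi i j < x)%R%:Z *~ (-1).
    by rewrite mulrN1z mulrN1 opprK.
  apply: local_slopeD; last first.
    exact/(@local_slopeMz _ (fun z => _))/local_slope_hinge_left.
  apply: local_slopeD; first exact: (@local_slope_affine _ _ _ (-1)).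
  by apply: local_slope_pairing => p; apply/on_edge_local_slope/local_slope_hinge_left.
exists (Num.min r x); first by rewrite lt_min r0.
move=> eps /andP[eps0]; rewrite lt_min => /andP[epsr eps1].
by rewrite !potential_edge ?hr ?eps0 //; apply/andP; split; lra.
Qed.

Lemma potential_has_slopes D phi : has_slopes (potential D phi).
Proof.
move=> e x; split=> xin.
  by exists (right_slope D phi (ends e).1 (ends e).2 x); apply: potential_right_slope.
by exists (left_slope D phi (ends e).1 (ends e).2 x); apply: potential_left_slope.
Qed.

Lemma div_potential_vertex D phi v :
  div_coeff (potential D phi) (inl v) = chips_of D phi v - coeff (inl v : point K) D.
Proof.
rewrite chips_ofE [RHS]addrAC [X in _ = X + _]addrAC subrr add0r /=.
rewrite -(sum_edge_src (fun ij => slope_of D phi ij.1 ij.2)).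
rewrite -(sum_edge_tgt (fun ij => mass D ij.1 ij.2 - slope_of D phi ij.1 ij.2
  - (chip_pos D phi ij.1 ij.2 < 1)%R%:Z)).
congr (_ + _); apply: eq_bigr => e _.
  rewrite (incoming_slopeE (potential_right_slope _ _ _ _)) ?lexx ?ltr01 //.
  rewrite /right_slope pairing_eq0 ?addr0 => [|[w|y]] /=.
  - have /andP[pos0 _] := chip_pos_itv D phi (ends e).1 (ends e).2.
    by rewrite leNgt pos0 addr0.
  - by left.
  - left; have /andP[y0 _] := valP y.
    by case: eqP => // _; rewrite leNgt y0.
rewrite (incoming_slopeE (potential_left_slope _ _ _ _)) ?lexx ?ltr01 //.
rewrite /left_slope [- _ + _]addrC; congr (_ - _ - _).
apply: eq_bigr => p _; congr (_ *~ _); case: p => //= y.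
by have /andP[_ y1] := valP y; rewrite y1.
Qed.

Lemma div_potential_interior D phi (x : edge_interior K) :
  div_coeff (potential D phi) (inr x) =
  (chip_pos D phi (ends (val x).1).1 (ends (val x).1).2 == (val x).2)%:Z
  - coeff (inr x : point K) D.
Proof.
have /andP[x0 x1] := valP x.
rewrite /= (incoming_slopeE (potential_right_slope _ _ _ _)) ?x1 ?ltW //.
rewrite (incoming_slopeE (potential_left_slope _ _ _ _)) ?x0 ?ltW //.
rewrite /right_slope /left_slope.
set i := (ends _).1; set j := (ends _).2; set t := (val x).2.
(* The two hinge slopes cancel except for the kinks at [t], so their sum picks out the coefficient
   at [x]. *)
have <- : pairing (on_edge i j (fun y => - (y <= t)%R%:Z)) D +
    pairing (on_edge i j (fun y => (y < t)%R%:Z)) D = - coeff (inr x : point K) D.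
  rewrite -pairingDl -sub0r; apply: (canRL (addrK _)).
  rewrite coeff_pairing -pairingDl; apply: pairing_eq0 => p; left.
  case: p => [v|y] //=.
  have -> : (inr y == inr x :> point K) =
      (ends (val y).1 == ends (val x).1) && ((val y).2 == t).
    apply/eqP/andP => [[->]//|[/eqP/val_inj e_xy /eqP t_xy]].
    congr inr; apply: val_inj.
    by rewrite [LHS]surjective_pairing e_xy t_xy -surjective_pairing.
  rewrite -surjective_pairing; case: (ends _ == _) => //=.
  by case: ltgtP.
have <- : (chip_pos D phi i j <= t)%R%:Z - (chip_pos D phi i j < t)%R%:Z =
    (chip_pos D phi i j == t)%:Z by case: ltgtP.
by ring.
Qed.

(** At [chip_pos] 1, [edge_point] would return the target vertex, whose chips are all in [chips_of]
    already; hence the coefficient 0 there. *)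
Definition normal_form D phi : divisor K :=
  \sum_v << chips_of D phi v *g (inl v : point K) >> +
  \sum_(e : edge K) << (chip_pos D phi (ends e).1 (ends e).2 < 1)%R%:Z
                       *g edge_point e (chip_pos D phi (ends e).1 (ends e).2) >>.

Lemma coeff_vertex_sum (c : 'I_d -> int) p :
  coeff p (\sum_v << c v *g (inl v : point K) >>) = if p is inl v then c v else 0.
Proof.
rewrite raddf_sum /=; case: p => [v|x].
  rewrite (bigD1 v) //= coeffU eqxx mulr1 big1 ?addr0 // => i iv; rewrite coeffU.
  by case: eqP => [[vi]|_]; [rewrite vi eqxx in iv | rewrite mulr0].
by rewrite big1 // => i _; rewrite coeffU mulr0.
Qed.

Lemma coeff_normal_vertex D phi v :
  coeff (inl v) (normal_form D phi) = chips_of D phi v.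
Proof.
rewrite coeffD coeff_vertex_sum raddf_sum big1 ?addr0 // => e _ /=; rewrite coeffU.
set p := chip_pos _ _ _ _.
have [p1|p1] := ltP p 1; last by rewrite mul0r.
have [|x -> _] := @edge_point_interior _ K e p; last by rewrite mulr0.
by have /andP[-> _] := chip_pos_itv D phi (ends e).1 (ends e).2.
Qed.

Lemma coeff_normal_interior D phi (x : edge_interior K) :
  coeff (inr x) (normal_form D phi) =
  (chip_pos D phi (ends (val x).1).1 (ends (val x).1).2 == (val x).2)%:Z.
Proof.
rewrite coeffD coeff_vertex_sum add0r raddf_sum (bigD1 (val x).1) //= [X in _ + X]big1.
  rewrite coeffU addr0; set p := chip_pos _ _ _ _.
  have /andP[x0 x1] := valP x; have [px|px] := eqVneq p (val x).2.
    by rewrite px x1 (@edge_point_val _ K x) eqxx.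
  case: eqP => [pE|_]; last by rewrite mulr0.
  have [p1|] := ltP p 1; last by rewrite mul0r.
  have [|y yE valy] := @edge_point_interior _ K (val x).1 p.
    by have /andP[-> _] := chip_pos_itv D phi (ends (val x).1).1 (ends (val x).1).2.
  by move: pE px; rewrite yE => -[<-]; rewrite valy eqxx.
move=> e ex; rewrite coeffU; set p := chip_pos _ _ _ _.
have [p1|] := ltP p 1; last by rewrite mul0r.
have [|y -> valy] := @edge_point_interior _ K e p.
  by have /andP[-> _] := chip_pos_itv D phi (ends e).1 (ends e).2.
case: eqP => [[yx]|_]; last by rewrite mulr0.
by move: ex; rewrite -yx valy eqxx.
Qed.

Lemma principal_normal_form D phi :
  is_principal (potential D phi) (normal_form D phi - D).
Proof.
case=> [v|x]; rewrite coeffB.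
  by rewrite coeff_normal_vertex div_potential_vertex.
by rewrite coeff_normal_interior div_potential_interior.
Qed.

Lemma linear_system_neq0 D phi : (forall v, 0 <= chips_of D phi v) ->
  (linear_system D !=set0)%classic.
Proof.
move=> ge0; exists (normal_form D phi); split.
  by case=> [v|x]; rewrite ?coeff_normal_vertex ?coeff_normal_interior.
exists (potential D phi); first exact/has_slopes_rational/potential_has_slopes.
exact: principal_normal_form.
Qed.

(** Subtracting the potential turns an equivalence of [E] with [D] into one with the normal form,
    which [not_equiv_effective] excludes. *)
Lemma linear_system_eq0 D phi (v0 : 'I_d) : (forall v, chips_of D phi v < 0) ->
  ~ (linear_system D !=set0)%classic.
Proof.
move=> lt0 [E [E_ge0 [f /rational_has_slopes fS fdiv]]].
have hS := potential_has_slopes D phi.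
apply: (@not_equiv_effective _ K (normal_form D phi) E
    (fun p => f p - potential D phi p) v0) => //.
- by move=> v; rewrite coeff_normal_vertex.
- move=> e; exists (chip_pos D phi (ends e).1 (ends e).2) => t tin.
  have [x -> xE] := edge_point_interior tin.
  by rewrite coeff_normal_interior xE eq_sym.
- exact/has_slopes_rational/has_slopesB.
- move=> p; rewrite div_coeffB // -fdiv -principal_normal_form !coeffB; ring.
Qed.

End CompleteGraph.

(** * Rank and gonality *)

Section Gonality.
Variables (R : realType) (d : nat) (v0 : 'I_d).
Local Notation K := (complete_metric_graph R d).
Implicit Types D E : divisor K.

Definition vertex_sum (c : 'I_d -> int) : divisor K :=
  \sum_v << c v *g (inl v : point K) >>.

Lemma deg_vertex_sum c : deg (vertex_sum c) = \sum_v c v.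
Proof.
rewrite /vertex_sum (raddf_sum (@deg _)); apply: eq_bigr => v _.
by rewrite /= degU.
Qed.

Lemma effective_vertex_sum c : (forall v, 0 <= c v) -> effective (vertex_sum c).
Proof. by move=> c_ge0 [v|x]; rewrite coeff_vertex_sum. Qed.

Lemma pairing_vertex_sum (V : zmodType) i j (F : R -> V) c :
  pairing (on_edge i j F) (vertex_sum c) = 0.
Proof.
apply: pairing_eq0 => -[v|x]; first by left.
by right; rewrite coeff_vertex_sum.
Qed.

(** Chips at vertices enter neither masses nor moments, so the same [phi] can be kept. *)
Lemma chips_of_subvertices D c phi v :
  chips_of (D - vertex_sum c) phi v = chips_of D phi v - c v.
Proof.
rewrite /chips_of /chips /base coeffB coeff_vertex_sum.
under eq_bigr do rewrite /mass pairingB pairing_vertex_sum subr0.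
under [X in _ + X = _]eq_bigr do
  rewrite /offset /shift /moment !pairingB !pairing_vertex_sum !subr0.
by rewrite -[in RHS]addrA -!addrA; congr (_ + _); rewrite addrC -addrA.
Qed.

Lemma rank_at_leastW D r r' : r' <= r -> rank_at_least D r -> rank_at_least D r'.
Proof.
move=> r'r rk E E_ge0 degE; set X := vertex_sum (fun v => (v == v0)%:Z * (r - r')).
have X_ge0 : effective X.
  by apply: effective_vertex_sum => v; case: (_ == _); rewrite ?mul0r // mul1r subr_ge0.
have degX : deg X = r - r'.
  rewrite deg_vertex_sum (bigD1 v0) //= eqxx mul1r big1 ?addr0 //.
  by move=> v /negbTE->; rewrite mul0r.
have [||F [F_ge0 [f fR fdiv]]] := rk (E + X).
- by move=> p; rewrite coeffD addr_ge0.
- by rewrite degD degE degX addrC subrK.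
exists (F + X); split; first by move=> p; rewrite coeffD addr_ge0.
by exists f => //; have -> : F + X - (D - E) = F - (D - (E + X)) by rewrite !opprB -!addrA (addrCA X).
Qed.

Lemma rank_at_least_gapfree D r : rank_at_least D r -> exists z : 'I_d -> int,
  [/\ gapfree z, r < (\sum_v pos_part z v)%N%:Z &
    2 * \sum_v z v = 2 * deg D + 2 * d%:Z - (d * (d - 1))%:Z].
Proof.
move=> rk.
have [phi gen gap] := exists_gapfree (base D) (@shiftN _ _ D).
pose z v := chips_of D phi v + 1; exists z; split.
- move=> m i j im mj; have [||l chl] := gap (m - 1) i j.
  + by rewrite ltrBrDr.
  + by rewrite ltrBlDr.
  + by exists l; rewrite /z /chips_of chl subrK.
- rewrite ltNge; apply/negP => le_r.
  (* Removing [c] leaves -1 minus the negative part of [z] at every vertex. *)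
  set c := fun v => (pos_part z v)%:Z.
  apply: (@linear_system_eq0 _ _ (D - vertex_sum c) phi v0) => [v|].
    rewrite chips_of_subvertices /c.
    move: (pos_neg_part z v); rewrite [in LHS]/z.
    by move: (chips_of _ _ _) (pos_part z v) (neg_part z v) => x p n; clear; lia.
  apply: (rank_at_leastW le_r rk); first exact: effective_vertex_sum.
  by rewrite deg_vertex_sum (big_morph Posz PoszD (erefl 0%Z)).
- have := sum_chips (base D) (@shiftN _ _ D) gen; rewrite sum_base card_ord.
  rewrite -/(chips_of D) => E; rewrite big_split /= sumr_const card_ord mulrDr E.
  by rewrite addrAC (natz d).
Qed.

(** Since S > r >= k(k+1)/2, there are at least k+1 positive values, hence at most d-2-k negative
    ones if any occur, and this bounds their sum. *)
Lemma rank_degree_small D (r k h : nat) : rank_at_least D r%:Z -> (h <= k)%N ->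
  (2 * (r + h) = k * (k + 3))%N -> k%:Z * d%:Z - h%:Z <= deg D.
Proof.
move=> /rank_at_least_gapfree[z [gap lt_r sumz]] hk rE.
rewrite sum_pos_neg_part in sumz.
set S := (\sum_v pos_part z v)%N in lt_r sumz.
set N' := (\sum_v neg_part z v)%N in sumz.
suff /(plane_degree_bound rE lt_r sumz) : 2 * N'%:Z <=
  (d%:Z - 2 - k%:Z) * (d%:Z - 1 - k%:Z) by [].
have [[i zi]|no] := pselect (exists i, z i < 0); last first.
  have -> : N' = 0%N.
    apply: big1 => i _; rewrite /neg_part; case E : (z i) => [//|n].
    by case: no; exists i; rewrite E.
  exact: consecutive_ge0.
have S_gt0 : (0 < S)%N by move: (S) lt_r; clear; lia.
have [P [N [PN N_gt0 SP N'N]]] := gapfree_sums gap zi S_gt0.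
rewrite -/S -/N' card_ord in PN SP N'N.
have lt_rS : (r < S)%N by [].
have kP : (k < P)%N by apply: triangle_lt SP; move: (S) lt_rS; clear -rE hk; nia.
by move: (N') N'N; clear -PN kP; nia.
Qed.

(** A negative value would leave at most d-2 positive ones, with sum at most (d-1)(d-2)/2 <= r < S.
    So [z] is nonnegative and its sum gives the degree. *)
Lemma rank_degree_large D (r : nat) : rank_at_least D r%:Z ->
  ((d - 1) * (d - 2) %/ 2 <= r)%N ->
  ((d - 1) * (d - 2) %/ 2)%N%:Z + r%:Z <= deg D.
Proof.
move=> /rank_at_least_gapfree[z [gap lt_r sumz]] gr.
rewrite sum_pos_neg_part in sumz.
set S := (\sum_v pos_part z v)%N in lt_r sumz.
set N' := (\sum_v neg_part z v)%N in sumz.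
have lt_rS : (r < S)%N by [].
have gE := double_genus d.
have [[i zi]|no] := pselect (exists i, z i < 0); last first.
  have N0 : N' = 0%N.
    apply: big1 => i _; rewrite /neg_part; case E : (z i) => [//|n].
    by case: no; exists i; rewrite E.
  rewrite N0 subr0 in sumz.
  by apply: nonspecial_degree_bound gE lt_rS sumz; apply: leq_ltn_trans (ltn_ord v0).
have S_gt0 : (0 < S)%N by apply: leq_ltn_trans lt_rS.
have [P [N [PN N_gt0 SP _]]] := gapfree_sums gap zi S_gt0.
rewrite -/S card_ord in PN SP; exfalso.
by move: (S) SP lt_rS; clear -PN N_gt0 gE gr; nia.
Qed.

Lemma linear_system_neq0_large D : ((d - 1) * (d - 2) %/ 2)%N%:Z <= deg D ->
  (linear_system D !=set0)%classic.
Proof.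
move=> gD; have [[phi ge0]|[phi gen lt0]] := chips_dichotomy (base D) (shift D) v0.
  exact: linear_system_neq0 ge0.
have := sum_chips (base D) (@shiftN _ _ D) gen; rewrite sum_base card_ord.
have : \sum_i chips (base D) (shift D) phi i <= - d%:Z.
  have -> : - d%:Z = \sum_(i < d) (-1) by rewrite sumr_const card_ord mulNrn (natz d).
  by apply: ler_sum => i _; have := lt0 i; lia.
move=> sum_le sumE; exfalso.
apply: nonspecial_sum_bound (double_genus d) gD sum_le sumE.
exact: leq_ltn_trans (ltn_ord v0).
Qed.

(** Either more than k values are positive and distinct, or at least d-1-k are negative and
    distinct; then the known total forces the positive part up. *)
Lemma injective_sum_bound (z : 'I_d -> int) (k : nat) : injective z -> (k < d)%N ->
    2 * \sum_i z i = 2 * (k%:Z * d%:Z) + 2 * d%:Z - (d * (d - 1))%:Z ->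
  ((k + 1) * (k + 2) <= 2 * \sum_i pos_part z i)%N.
Proof.
move=> /injective_sums[P [N []]]; rewrite sum_pos_neg_part card_ord.
move: (\sum_i pos_part z i)%N (\sum_i neg_part z i)%N => S N' PN SP NN' kd sumz.
have [kP|Pk] := leqP k.+1 P; first by clear -kP SP; nia.
have N_ge : (d - 1 - k <= N)%N by lia.
have : ((d - 1 - k) * (d - 1 - k + 1) <= 2 * N')%N.
  by apply: leq_trans (leq_mul _ _) NN'; rewrite ?leq_add2r.
by clear -kd sumz; nia.
Qed.

(* [z] belongs to the divisor [k] times the sum of the vertices, at a generic
   perturbation [psi] of [phi]; subtracting [E] lowers it by a vector [e >= 0] of
   total [deg E]. *)
Lemma linear_system_neq0_plane E (k : nat) : effective E -> (k < d)%N ->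
    2 * deg E = (k * (k + 3))%N%:Z ->
  (linear_system (vertex_sum (fun=> k%:Z) - E) !=set0)%classic.
Proof.
move=> E_ge0 kd degE; set F := _ - E.
have [[phi ge0]|[phi gen lt0]] := chips_dichotomy (base F) (shift F) v0.
  exact: linear_system_neq0 ge0.
exfalso; pose t0 (i j : 'I_d) : R := 0.
have t0N i j : t0 i j = - t0 j i by rewrite oppr0.
(* [phi] is generic for [shift F] only; a small multiple of the index makes it generic for the zero
   shift as well. *)
have [r r0 rP] := offset_perturb t0 phi (fun i => (i : nat)%:R).
pose psi (l : 'I_d) := phi l + r / 2 * (l : nat)%:R.
have {}rP i j : Num.floor (offset t0 psi i j) = Num.floor (offset t0 phi i j)
      - ((j%:R < i%:R :> R) && (offset t0 phi i j \is a Num.int))%:Z /\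
    (offset t0 psi i j \is a Num.int) =
      (j%:R == i%:R :> R) && (offset t0 phi i j \is a Num.int).
  by apply: rP; apply/andP; split; lra.
have gen0 : generic t0 psi.
  move=> i j; rewrite (rP i j).2 eqr_nat => ij.
  by rewrite eq_sym (inj_eq val_inj) (negbTE ij).
pose z i := chips (fun=> k%:Z) t0 psi i + 1.
(* With zero shift, all offsets from [j] are below those from [i], and the one towards [i] is
   negative. *)
have z_lt i j : psi i < psi j -> z j < z i.
  move=> ij; rewrite ltrD2r ltrD2l (bigD1 i) //= [ltRHS](bigD1 i) //=.
  rewrite ltr_leD //; last first.
    by apply: ler_sum => l _; apply: le_floor; rewrite /offset; lra.
  by rewrite offset_diag // floor0 floor_lt0 /offset /t0; lra.
have z_inj : injective z.
  move=> i j zij; apply/eqP; apply: contraT => ij.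
  have [/z_lt|/z_lt|psiE] := ltgtP (psi i) (psi j); rewrite ?zij ?ltxx //.
  by have := gen0 _ _ ij; rewrite /offset psiE add0r subrr int_num0.
pose A i j := Num.floor (offset t0 psi i j).
pose B i j := Num.floor (offset (shift F) phi i j).
(* Each chip contributes 1 - x, between 0 and 1, to the moment, and 1 to the mass. *)
have momentE i j : 0 <= moment E i j <= (mass E i j)%:~R.
  have E0 (p : point K) : 0 <= coeff p E by apply: E_ge0.
  have -> : (mass E i j)%:~R = pairing (on_edge i j (fun=> 1 : R)) E.
    rewrite /mass /pairing rmorph_sum; apply: eq_bigr => p _ /=.
    rewrite mulrzz intrM mulrC mulrzl; congr (_ *~ _).
    by case: p => //= x; case: ifP.
  have pairing0 : pairing (fun=> 0 : R) E = 0 by apply: pairing_eq0 => p; left.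
  apply/andP; split; first apply: le_trans (_ : pairing (fun=> 0 : R) E <= _).
  - by rewrite pairing0.
  - apply: pairing_le => // -[v|x] //=; case: ifP => // _.
    by have /andP[_ x1] := valP x; rewrite subr_ge0 ltW.
  - apply: pairing_le => // -[v|x] //=; case: ifP => // _.
    by have /andP[x0 _] := valP x; rewrite lerBlDr lerDl ltW.
have AB_lt (i j : 'I_d) : (i < j)%N -> 0 <= A i j - B i j <= mass E i j.
  move=> ij; rewrite /A (rP i j).1 /B.
  have -> : offset (shift F) phi i j = offset t0 phi i j - moment E i j.
    rewrite /offset shift_lt // /moment pairingB pairing_vertex_sum /t0.
    by rewrite /moment; lra.
  apply: floor_shift_bound => //.
  have := gen i j; rewrite /offset shift_lt // /moment pairingB pairing_vertex_sum.
  rewrite sub0r /t0 -/(moment E i j) => nint.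
  have -> : 0 + phi j - phi i - moment E i j = - moment E i j + phi j - phi i by lra.
  by apply: nint; rewrite neq_ltn ij.
have AB_ge0 i j : 0 <= mass E j i + A i j - B i j.
  case: (ltngtP i j) => [ij|ji|/val_inj<-].
  - by rewrite mass0 ?add0r ?(ltnW ij) //; case/andP: (AB_lt _ _ ij).
  - have ij : j != i by rewrite neq_ltn ji.
    have /andP[_] := AB_lt _ _ ji; rewrite /A /B.
    rewrite [offset t0 psi i j]offsetC // [offset (shift F) phi i j]offsetC;
      last exact: shiftN.
    rewrite !floorNnint gen // gen0 //.
    by move: (Num.floor _) (Num.floor _) (mass _ _ _) => a b m; clear; lia.
  - by rewrite mass0 // /A /B !offset_diag // ?floor0 //; apply: shiftN.
pose e i := z i - (chips_of F phi i + 1).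
have e_ge0 i : 0 <= e i.
  have -> : e i = coeff (inl i : point K) E + \sum_j (mass E j i + A i j - B i j).
    rewrite /e /z /chips_of /chips /base sumrB big_split /= -/(A i) -/(B i).
    rewrite coeffB coeff_vertex_sum.
    have -> : \sum_j mass F j i = - \sum_j mass E j i.
      rewrite -sumrN; apply: eq_bigr => j _.
      by rewrite /mass pairingB pairing_vertex_sum sub0r.
    by rewrite /A /B; ring.
  by rewrite addr_ge0 ?sumr_ge0.
have constE (c : int) : \sum_(i < d) c = c * d%:Z.
  by rewrite sumr_const card_ord -mulr_natr (natz d).
have sum_z : 2 * \sum_i z i = 2 * (k%:Z * d%:Z) + 2 * d%:Z - (d * (d - 1))%:Z.
  rewrite big_split /= mulrDr (sum_chips _ t0N gen0) !constE card_ord.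
  by ring.
have sum_c : 2 * \sum_i (chips_of F phi i + 1) =
    2 * (k%:Z * d%:Z - deg E) + 2 * d%:Z - (d * (d - 1))%:Z.
  rewrite big_split /= mulrDr (sum_chips (base F) (@shiftN _ _ F) gen) sum_base.
  by rewrite degB deg_vertex_sum !constE card_ord; ring.
have sum_e : 2 * \sum_i e i = 2 * deg E by rewrite sumrB mulrBr sum_z sum_c; ring.
(* Negative chips mean that [e] brings each [z i] down to 0 or below. The total needed is at least
   (k+1)(k+2)/2, one more than [deg E]. *)
have pos_e : \sum_i (pos_part z i)%:Z <= \sum_i e i.
  apply: ler_sum => i _; have := e_ge0 i; have := lt0 i; rewrite /e -/(chips_of F).
  move: (chips_of _ _ _); rewrite /pos_part; case: (z i) => n c; clear; lia.
have := injective_sum_bound z_inj kd sum_z; move: pos_e; rewrite -(big_morph Posz PoszD (erefl 0%Z)).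
move: (\sum_i pos_part z i)%N (\sum_i e i) (deg E) sum_e degE => S u s; clear -kd.
by nia.
Qed.

(** The strict inequality for [r.+1] prevents the rank of [D] from exceeding [r]. *)
Lemma gonality_intro D (r : nat) : rank_at_least D r%:Z ->
    (forall D', rank_at_least D' r%:Z -> deg D <= deg D') ->
    (forall D', rank_at_least D' r.+1%:Z -> deg D < deg D') ->
  gonality K r (deg D).
Proof.
move=> rk le_deg lt_deg; split=> [|D' [[_ //]|[_ _ rk' _]]]; last exact: le_deg.
exists D => //; right; split=> //.
- have := rank_at_leastW (_ : 0 <= r%:Z) rk.
  by move=> /(_ isT 0); rewrite subr0; apply=> [p|]; rewrite ?coeff0 ?deg0.
- move=> r' r'_ge0 rk'; rewrite leNgt; apply/negP => lt_r.
  have /lt_deg : rank_at_least D r.+1%:Z by apply: rank_at_leastW rk'; lia.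
  by rewrite ltxx.
Qed.

Lemma gonality_small (r k h : nat) : (k.+1 < d)%N -> (h <= k)%N ->
  (2 * (r + h) = k * (k + 3))%N -> gonality K r (k%:Z * d%:Z - h%:Z).
Proof.
move=> kd hk rE; pose X := vertex_sum (fun v => (v == v0)%:Z * h%:Z).
have X_ge0 : effective X by apply: effective_vertex_sum => v; case: (_ == _); lia.
have degX : deg X = h.
  rewrite deg_vertex_sum (bigD1 v0) //= eqxx mul1r big1 ?addr0 //.
  by move=> v /negbTE->; rewrite mul0r.
pose D := vertex_sum (fun=> k%:Z) - X.
have degD : deg D = k%:Z * d%:Z - h%:Z.
  by rewrite degB degX deg_vertex_sum sumr_const card_ord -mulr_natr (natz d).
rewrite -degD; apply: gonality_intro => [E E_ge0 degE|D' rk|D' rk].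
- rewrite -addrA -opprD; apply: linear_system_neq0_plane (ltnW kd) _ => [p|].
    by rewrite coeffD addr_ge0.
  by rewrite freeg.degD degX degE -rE; clear; lia.
- by rewrite degD; apply: rank_degree_small rk hk rE.
(* The indices of r+1 are k and h-1, or k+1 and k+1 when h = 0; in the latter case (k+1)(d-1) > kd
   because k+1 < d. *)
- rewrite degD; have [h0|h_gt0] := posnP h; last first.
    have := rank_degree_small rk (_ : h.-1 <= k)%N; move: (deg D') => s.
    by have [] : (h.-1 <= k)%N /\ (2 * (r.+1 + h.-1) = k * (k + 3))%N; [lia | move=> hk' rE' /(_ hk' rE'); lia].
  have := rank_degree_small rk (leqnn k.+1); move: (deg D') => s.
  have rE' : (2 * (r.+1 + k.+1) = k.+1 * (k.+1 + 3))%N by nia.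
  by move=> /(_ rE'); nia.
Qed.

Lemma gonality_large (r : nat) : ((d - 1) * (d - 2) %/ 2 <= r)%N ->
  gonality K r (((d - 1) * (d - 2) %/ 2)%N%:Z + r%:Z).
Proof.
set g := (_ %/ 2)%N => gr.
pose D := vertex_sum (fun v => (v == v0)%:Z * (g%:Z + r%:Z)).
have degD : deg D = g%:Z + r%:Z.
  rewrite deg_vertex_sum (bigD1 v0) //= eqxx mul1r big1 ?addr0 //.
  by move=> v /negbTE->; rewrite mul0r.
rewrite -degD; apply: gonality_intro => [E E_ge0 degE|D' rk|D' rk].
- by apply: linear_system_neq0_large; rewrite degB degD degE addrK.
- by rewrite degD; apply: rank_degree_large rk gr.
- have := rank_degree_large rk (leqW gr); rewrite degD -/g; move: (deg D') => s.
  by clear; lia.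
Qed.

End Gonality.

(** * Existence and uniqueness of the indices *)

Lemma gonality_indicesE d r k h : gonality_indices d r k h <->
  [/\ (1 <= k <= d - 3)%N, (h <= k)%N & (2 * (r + h) = k * (k + 3))%N].
Proof.
have half : (2 * (k * (k + 3) %/ 2) = k * (k + 3))%N.
  by rewrite mulnC divnK // dvdn2 oddM oddD addbT andbN.
by split=> -[? ? ?]; split=> //; nia.
Qed.

Lemma exists_gonality_indices d r : (1 <= r)%N -> (r < (d - 1) * (d - 2) %/ 2)%N ->
  exists k h, gonality_indices d r k h.
Proof.
move=> r_ge1 rg; have gE := double_genus d.
have ex : exists k, (2 * r <= k * (k + 3))%N by exists r; nia.
have [k rk k_min] := ex_minnP ex.
have k_gt0 : (0 < k)%N by case: (k) rk => //; lia.
have lt_r : (k.-1 * (k.-1 + 3) < 2 * r)%N.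
  by rewrite ltnNge; apply/negP => /k_min; lia.
(* [k] is the least number with r <= k(k+3)/2, and g - 1 = (d-3)d/2 makes d-3 a candidate. *)
have kd : (k <= d - 3)%N by apply: k_min; nia.
have [h hE] : exists h, (2 * h = k * (k + 3) - 2 * r)%N.
  exists ((k * (k + 3) - 2 * r) %/ 2)%N; rewrite mulnC divnK // dvdn2 oddB //.
  by rewrite !oddM oddD addbT andbN.
exists k, h; apply/gonality_indicesE; split; [lia | nia | lia].
Qed.

Lemma gonality_indices_uniq d r k h k' h' :
  gonality_indices d r k h -> gonality_indices d r k' h' -> k' = k /\ h' = h.
Proof.
move=> /gonality_indicesE[_ hk rE] /gonality_indicesE[_ hk' rE'].
(* The values for a given k run from k(k+1)/2 to k(k+3)/2, and those for k+1 start just after. *)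
have kk' : k' = k.
  by case: (ltngtP k' k) => // lt; exfalso; nia.
by split=> //; rewrite kk' in rE'; lia.
Qed.

Theorem theorem21 (R : realType) (d r : nat) (d_gt0 : (0 < d)%N)
    (r_ge1 : (1 <= r)%N) :
  let g := ((d - 1) * (d - 2) %/ 2)%N in
  let K_d := complete_metric_graph R d in
  ((r < g)%N ->
     exists k h : nat,
       [/\ gonality_indices d r k h,
           forall k' h' : nat, gonality_indices d r k' h' -> k' = k /\ h' = h &
           gonality K_d r (k%:Z * d%:Z - h%:Z)]) /\
  ((g <= r)%N -> gonality K_d r (g%:Z + r%:Z)).
Proof.
move=> g K_d; have v0 : 'I_d := Ordinal d_gt0.
split=> [rg|gr]; last exact: gonality_large.
have [k [h kh]] := exists_gonality_indices r_ge1 rg.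
exists k, h; split=> // [k' h'|]; first exact: gonality_indices_uniq kh.
have /gonality_indicesE[/andP[_ kd] hk rE] := kh.
by apply: gonality_small => //; lia.
Qed.
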